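(* Let $S\subset\mathbb{R}^2$ be a convex set such that $S$ contains a congruent copy (image under a translation and rotation) of each of the following three sets: the circle of perimeter $1$ (radius $\frac{1}{2\pi}$), the equilateral triangle of perimeter $1$ (side $\frac13$), and the rectangle of size $0.0375\times 0.4625$ (perimeter $1$). Then the area of $S$ is at least $0.0975$. *)

(* Defs.v *)
From HB Require Import structures.
From mathcomp Require Import all_boot all_order all_algebra.
From mathcomp Require Import all_classical all_reals all_analysis.
Set Implicit Arguments. Unset Strict Implicit. Unset Printing Implicit Defensive.
Import Order.TTheory GRing.Theory Num.Theory.
Local Open Scope classical_set_scope.
Local Open Scope ring_scope.

Section Plane.
Variable R : realType.
Notation P := (R * R)%type.

Definition convex2 (S : set P) : Prop :=
  forall p q : P, S p -> S q -> forall t : R, 0 <= t -> t <= 1 ->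
    S ((1 - t) * p.1 + t * q.1, (1 - t) * p.2 + t * q.2).

Definition rigid (th : R) (v : P) (p : P) : P :=
  (cos th * p.1 - sin th * p.2 + v.1, sin th * p.1 + cos th * p.2 + v.2).

Definition contains_copy (S K : set P) : Prop :=
  exists (th : R) (v : P), rigid th v @` K `<=` S.

Definition segment (p q : P) : set P :=
  [set ((1 - t) * p.1 + t * q.1, (1 - t) * p.2 + t * q.2) | t in `[0, 1]%classic].

Definition circle1 : set P :=
  [set p | p.1 ^+ 2 + p.2 ^+ 2 = (1 / (2 * pi)) ^+ 2].

Definition triangle1 : set P :=
  let a : P := (0, 0) in
  let b : P := (1 / 3, 0) in
  let c : P := (1 / 6, Num.sqrt 3 / 6) in
  segment a b `|` segment b c `|` segment c a.

Definition rect1 : set P :=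
  let w : R := 3 / 80 in
  let h : R := 37 / 80 in
  segment (0, 0) (w, 0) `|` segment (w, 0) (w, h)
  `|` segment (w, h) (0, h) `|` segment (0, h) (0, 0).

(* area of S (two-dimensional Lebesgue (outer) measure) is at least c:
   every measurable set containing S has measure >= c.  For measurable S
   this is exactly  (lebesgue_measure \x lebesgue_measure) S >= c. *)
Definition area_ge (S : set P) (c : R) : Prop :=
  forall A : set P, measurable A -> S `<=` A ->
    (c%:E <= (@lebesgue_measure R \x @lebesgue_measure R) A)%E.

End Plane.

(* Main.v *)
Require Import Defs.
From HB Require Import structures.
From Stdlib Require Import ZArith.
From mathcomp Require Import all_boot all_order all_algebra.
From mathcomp Require Import all_classical all_reals all_analysis.
From mathcomp Require Import measurable_realfun ssrZ zify ring lra.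
Set Implicit Arguments. Unset Strict Implicit. Unset Printing Implicit Defensive.
Import Order.TTheory GRing.Theory Num.Theory.
Import numFieldNormedType.Exports.
Local Open Scope classical_set_scope.
Local Open Scope ring_scope.

(* Fix the rectangle, with its long side horizontal.  If the vertices of a polygon lie
   in the convex set S and consist of one list with nondecreasing and one with
   nonincreasing abscissas, then its signed area, given by the shoelace formula, is at
   most the area of S.  For a fixed choice of vertices on the rectangle, the disc and
   the triangle, this signed area is a polynomial in the positions of the disc and the
   triangle which is affine in each variable and in the direction z of the triangle.
   Hence a lower bound for a weighted mean of such areas over a box of positions, with z
   in a small cone, follows from its values at the vertices.  Near the optimal
   placement, no single polygon is good enough, but a mean of about five of them is,
   because the weights can be chosen such that the gradients cancel.  With these means,
   a subdivision of the space of placements into 92 parts suffices; it is checked by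
   computation on integers. *)

(** * Area-preserving maps *)

(** The convex hull of the three sets changes its combinatorial type with the placement. Signed
    areas avoid following it: a polygon need be neither convex nor simple, so one list of vertices
    serves a whole box, where only the monotonicity of its two parts has to be checked, and this is
    again a matter of extreme values.

    The space of placements is made bounded by two observations. The symmetry of the triangle under
    a third of a turn and that of the rectangle under a half-turn leave only directions z within 30
    degrees of the long side. A point too far from the rectangle spans with one of its sides a
    triangle of area above 0.0975, which confines the two centres.

    The directions on an arc do not form a polytope. They are enclosed in the quadrilateral given by
    two vectors of length about 1 at the ends of the arc and their multiples reaching the height of
    the intersection of the tangents.

    The points taken from the disc and the triangle are rounded inwards and therefore belong to S,
    so the integer computation carries no error terms. *)

Section AreaPreserving.
Variable R : realType.
Local Notation P := (R * R)%type.
Local Notation mu := (@lebesgue_measure R).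
Local Notation mu2 := (mu \x mu)%E.

Lemma lebesgue_measureD (d : R) (A : set (measurableTypeR R)) : measurable A ->
  mu ((fun y => y + d) @^-1` A) = mu A.
Proof.
move=> mA.
pose f : measurableTypeR R -> measurableTypeR R := fun y => y + d.
have mf : measurable_fun setT f by exact: measurable_funD.
suff -> : mu A = pushforward mu f A by [].
apply: lebesgue_measure_unique => //= _ [[a b]] _ <-.
rewrite /pushforward /f.
have -> : (fun y => y + d) @^-1` `]a, b]%classic = `]a - d, b - d]%classic.
  by apply/seteqP; split=> x /=; rewrite !in_itv /= ltrBlDr lerBrDr.
rewrite !lebesgue_measure_itv /= !lte_fin ltrD2r.
by case: ifP => // _; rewrite -!EFinB; congr (_%:E); ring.
Qed.

(** Exchanging the order of integration makes horizontal sections available, which a horizontal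
    shear translates. *)
Lemma product_measure12 (A : set (measurableTypeR R * measurableTypeR R)) : measurable A ->
  mu2 A = (mu \x^ mu)%E A.
Proof.
move=> mA; apply: product_measure_unique => // X Y mX mY.
exact: product_measure2E.
Qed.

(** Preimages are used because [area_ge] speaks of measurable supersets: those of S pull back to
    measurable supersets of the preimage of S. *)
Definition area_preserving (f : P -> P) :=
  forall A : set P, measurable A -> measurable (f @^-1` A) /\ mu2 (f @^-1` A) = mu2 A.

Lemma area_preserving_comp (f g : P -> P) :
  area_preserving f -> area_preserving g -> area_preserving (f \o g).
Proof.
move=> hf hg A mA; have [mfA fA] := hf _ mA; have [mgA gA] := hg _ mfA.
by split; rewrite comp_preimage // gA.
Qed.

(** The section over x is translated by k x + d, so the integrands of the two product measures
    agree. *)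
Lemma area_preserving_vshear (k d : R) :
  area_preserving (fun p => (p.1, p.2 + (k * p.1 + d))).
Proof.
move=> A mA; split.
  rewrite -[X in measurable X]setTI.
  have mf : measurable_fun setT (fun p : measurableTypeR R * measurableTypeR R => (p.1, p.2 + (k * p.1 + d))).
    apply: measurable_fun_pair => //=.
    apply: measurable_funD => //; apply: measurable_funD => //.
    exact: measurable_funM.
  exact: mf.
rewrite /product_measure1; apply: eq_integral => x _ /=.
rewrite -[RHS](lebesgue_measureD (k * x + d)); last exact: measurable_xsection.
by congr (mu _); apply/seteqP; split => y /=; rewrite /xsection /= !inE.
Qed.

Lemma area_preserving_hshear (k d : R) :
  area_preserving (fun p => (p.1 + (k * p.2 + d), p.2)).
Proof.
move=> A mA.
have mfA : measurable ((fun p : P => (p.1 + (k * p.2 + d), p.2)) @^-1` A).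
  rewrite -[X in measurable X]setTI.
  have mf : measurable_fun setT (fun p : measurableTypeR R * measurableTypeR R => (p.1 + (k * p.2 + d), p.2)).
    apply: measurable_fun_pair => //=.
    apply: measurable_funD => //; apply: measurable_funD => //.
    exact: measurable_funM.
  exact: mf.
split => //.
rewrite !product_measure12 // /product_measure2; apply: eq_integral => y _ /=.
rewrite -[RHS](lebesgue_measureD (k * y + d)); last exact: measurable_ysection.
by congr (mu _); apply/seteqP; split => x /=; rewrite /ysection /= !inE.
Qed.

Definition isometry (c s : R) (v p : P) : P :=
  (c * p.1 - s * p.2 + v.1, s * p.1 + c * p.2 + v.2).

(* A rotation of angle x is the product of the shears of slopes
   - tan (x / 2), sin x, - tan (x / 2), where tan (x / 2) = s / (1 + c). *)
Lemma area_preserving_isometry (c s : R) (v : P) :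
  c ^+ 2 + s ^+ 2 = 1 -> 0 <= c -> area_preserving (isometry c s v).
Proof.
move=> cs1 c0.
have c1 : 1 + c != 0 by lra.
have -> : isometry c s v =
   (fun p => (p.1 + (- (s / (1 + c)) * p.2 + (s / (1 + c) * v.2 + v.1)), p.2)) \o
   (fun p => (p.1, p.2 + (s * p.1 + v.2))) \o
   (fun p => (p.1 + (- (s / (1 + c)) * p.2 + 0), p.2)).
  apply/funext => -[x y]; rewrite /isometry /=.
  have ss : s * s = (1 + c) * (1 - c) by lra.
  congr (_, _); last first.
    have -> : s * (x + (- (s / (1 + c)) * y + 0)) = s * x - s * s / (1 + c) * y by field.
    rewrite ss; have -> : (1 + c) * (1 - c) / (1 + c) = 1 - c by field.
    by ring.
  have -> : x + (- (s / (1 + c)) * y + 0) +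
     (- (s / (1 + c)) * (y + (s * (x + (- (s / (1 + c)) * y + 0)) + v.2)) + (s / (1 + c) * v.2 + v.1))
     = x - (s * s) / (1 + c) * x - 2 * (s / (1 + c)) * y + (s * s) / (1 + c) * (s / (1 + c)) * y + v.1 by field.
  rewrite ss; have -> : (1 + c) * (1 - c) / (1 + c) = 1 - c by field.
  have -> : x - (1 - c) * x - 2 * (s / (1 + c)) * y + (1 - c) * (s / (1 + c)) * y + v.1 =
    c * x - (1 + c) / (1 + c) * s * y + v.1 by field.
  by rewrite divff // mul1r.
apply: area_preserving_comp; last exact: area_preserving_hshear.
by apply: area_preserving_comp; [exact: area_preserving_hshear|exact: area_preserving_vshear].
Qed.

Lemma area_ge_preimage (f : P -> P) (S : set P) (c : R) :
  area_preserving f -> area_ge (f @^-1` S) c -> area_ge S c.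
Proof.
move=> hf hS A mA SA; have [mfA <-] := hf _ mA.
by apply: hS => // p; exact: SA.
Qed.

End AreaPreserving.

(** * Polygons in convex sets *)

Section PolygonArea.
Variable R : realType.
Local Notation P := (R * R)%type.
Local Notation mu := (@lebesgue_measure R).
Local Notation mu2 := (mu \x mu)%E.

Lemma continuous_affine (c d : R) : continuous (fun x : R => c + d * x).
Proof.
move=> x; apply: cvgD; first exact: cvg_cst.
by apply: cvgM; [exact: cvg_cst|exact: cvg_id].
Qed.

Lemma integrable_affine (a b c d : R) :
  mu.-integrable `[a, b] (EFin \o (fun x => c + d * x)).
Proof.
apply: continuous_compact_integrable; first exact: segment_compact.
exact/continuous_subspaceT/continuous_affine.
Qed.

Lemma Rintegral_affine (a b c d : R) : a <= b ->
  \int[mu]_(x in `[a, b]) (c + d * x) = (b - a) * (c + d * (a + b) / 2).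
Proof.
rewrite le_eqVlt => /predU1P[<-|ab].
  by rewrite set_itv1 Rintegral_set1; ring.
pose F x := c * x + d / 2 * (x * x).
have dF (x : R) : is_derive x 1 F (c + d * x).
  rewrite /F; apply: is_derive_eq.
  by rewrite /GRing.scale /=; field.
have cF : continuous F.
  by move=> y; apply: differentiable_continuous; apply/derivable1_diffP; case: (dF y).
rewrite /Rintegral (@continuous_FTC2 _ _ F) //=.
- by rewrite /F; field.
- exact/continuous_subspaceT/continuous_affine.
- split.
  + by move=> y _; case: (dF y).
  + exact/cvg_at_right_filter/cF.
  + exact/cvg_at_left_filter/cF.
- by move=> y _; rewrite derive1E; case: (dF y).
Qed.

Implicit Types (p q : P) (s t : seq P) (S A : set P).

Definition le_fst p q := p.1 <= q.1.

(** Piecewise linear interpolation. Vertical edges are allowed: division by 0 yields 0, so the value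
    on such an edge is still the ordinate of a listed vertex. *)
Fixpoint graph p s (x : R) : R :=
  if s is q :: s' then
    if x <= q.1 then p.2 + (x - p.1) * ((q.2 - p.2) / (q.1 - p.1)) else graph q s' x
  else p.2.

Fixpoint trapezoids p s : R :=
  if s is q :: s' then (q.1 - p.1) * ((p.2 + q.2) / 2) + trapezoids q s' else 0.

Lemma path_le_last p s : path le_fst p s -> p.1 <= (last p s).1.
Proof.
by elim: s p => [|q s ih] p //= /andP[pq /ih]; apply: le_trans.
Qed.

Lemma graph_mem S p s x : convex2 S -> S p -> (forall q, q \in s -> S q) ->
  path le_fst p s -> p.1 <= x -> x <= (last p s).1 -> S (x, graph p s x).
Proof.
move=> cS; elim: s p => [|q s ih] p Sp Ss /=.
  move=> _ px xp; have -> : x = p.1 by apply/le_anti; rewrite px xp.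
  by case: (p) Sp.
move=> /andP[pq qs] px xl; have Sq : S q by apply: Ss; rewrite inE eqxx.
case: ifP => xq; last first.
  apply: ih => //; first by move=> r rs; apply: Ss; rewrite inE rs orbT.
  by rewrite ltW // ltNge xq.
have [pq1|pq1] := eqVneq q.1 p.1.
  have -> : x = p.1 by apply/le_anti; rewrite px -pq1 xq.
  by rewrite subrr mul0r addr0; case: (p) Sp.
have d0 : 0 < q.1 - p.1 by rewrite subr_gt0 lt_neqAle eq_sym pq1.
pose u := (x - p.1) / (q.1 - p.1).
have -> : (x, p.2 + (x - p.1) * ((q.2 - p.2) / (q.1 - p.1))) =
   ((1 - u) * p.1 + u * q.1, (1 - u) * p.2 + u * q.2).
  by rewrite /u; congr (_, _); field; rewrite gt_eqF.
apply: cS => //; first by rewrite divr_ge0 ?subr_ge0.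
by rewrite ler_pdivrMr // mul1r lerD2r.
Qed.

Lemma integrable_setU (D E : set (measurableTypeR R)) (f : measurableTypeR R -> \bar R) :
  measurable D -> measurable E -> [disjoint D & E] ->
  mu.-integrable D f -> mu.-integrable E f -> mu.-integrable (D `|` E) f.
Proof.
move=> mD mE DE /integrableP[mfD fD] /integrableP[mfE fE].
have mf : measurable_fun (D `|` E) f by apply/measurable_funU.
apply/integrableP; split => //.
rewrite ge0_integral_setU //; last exact: measurableT_comp.
exact: lte_add_pinfty.
Qed.

Lemma graph_integral p s : path le_fst p s ->
  mu.-integrable `[p.1, (last p s).1] (EFin \o graph p s) /\
  \int[mu]_(x in `[p.1, (last p s).1]) graph p s x = trapezoids p s.
Proof.
elim: s p => [|q s ih] p /=.
  move=> _; split.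
    have -> : EFin \o (fun=> p.2) = EFin \o (fun x => p.2 + 0 * x).
      by apply/funext => x /=; rewrite mul0r addr0.
    exact: integrable_affine.
  by rewrite set_itv1 Rintegral_set1.
move=> /andP[pq qs]; have [iq Iq] := ih _ qs; have ql := path_le_last qs.
pose k := (q.2 - p.2) / (q.1 - p.1).
pose g x := if x <= q.1 then p.2 + (x - p.1) * k else graph q s x.
have gE1 : {in `[p.1, q.1]%classic, g =1 (fun x => (p.2 - k * p.1) + k * x)}.
  move=> x; rewrite inE /= in_itv /= => /andP[_ xq].
  by rewrite /g xq; ring.
have gE2 : {in `]q.1, (last q s).1]%classic, g =1 graph q s}.
  move=> x; rewrite inE /= in_itv /= => /andP[qx _].
  by rewrite /g leNgt qx.
have U : `[p.1, (last q s).1]%classic = `[p.1, q.1]%classic `|` `]q.1, (last q s).1]%classic.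
  by rewrite (@itv_bndbnd_setU _ _ _ (BRight q.1)) // bnd_simp.
have i1 : mu.-integrable `[p.1, q.1] (EFin \o g).
  apply: eq_integrable (integrable_affine _ _ (p.2 - k * p.1) k) => //.
  by move=> x /gE1 /= ->.
have iq' : mu.-integrable `]q.1, (last q s).1] (EFin \o graph q s).
  by apply: integrableS iq => //; apply: subset_itvr; rewrite bnd_simp.
have i2 : mu.-integrable `]q.1, (last q s).1] (EFin \o g).
  by apply: eq_integrable iq' => //; move=> x /gE2 /= ->.
have dj : [disjoint `[p.1, q.1]%classic & `]q.1, (last q s).1]%classic].
  rewrite disj_set2E; apply/eqP/seteqP; split => // x [] /=; rewrite !in_itv /=.
  by move=> /andP[_ xq] /andP[]; rewrite ltNge xq.
have i12 : mu.-integrable `[p.1, (last q s).1] (EFin \o g).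
  by rewrite U; apply: integrable_setU.
split => //.
rewrite [LHS](_ : _ = \int[mu]_(x in `[p.1, (last q s).1]) g x) // U Rintegral_setU //; last by rewrite -U.
have -> : \int[mu]_(x in `[p.1, q.1]) g x =
    \int[mu]_(x in `[p.1, q.1]) (p.2 - k * p.1 + k * x) by exact: eq_Rintegral.
have -> : \int[mu]_(x in `]q.1, (last q s).1]) g x =
    \int[mu]_(x in `]q.1, (last q s).1]) graph q s x by exact: eq_Rintegral.
rewrite Rintegral_affine // Rintegral_itv_obnd_cbnd // Iq; congr (_ + _).
rewrite /k; have [->|qp] := eqVneq q.1 p.1; first by rewrite subrr !mul0r.
by field; rewrite subr_eq0.
Qed.

Definition cross p q := p.1 * q.2 - p.2 * q.1.

Fixpoint crosses p s : R := if s is q :: s' then cross p q + crosses q s' else 0.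

(** Twice a trapezoid is [q.1 * q.2 - p.1 * p.2 - cross p q], and the first two terms telescope.
    What remains of them cancels between two chains with the same ends. *)
Lemma trapezoids_crosses p s :
  2 * trapezoids p s = (last p s).1 * (last p s).2 - p.1 * p.2 - crosses p s.
Proof.
elim: s p => [|q s ih] p /=; first by ring.
by rewrite mulrDr ih /cross; field.
Qed.

Lemma crosses_rcons p s q : crosses p (rcons s q) = crosses p s + cross (last p s) q.
Proof. by elim: s p => [|r s ih] p /=; rewrite ?ih; ring. Qed.

Lemma crosses_cat p s t : crosses p (s ++ t) = crosses p s + crosses (last p s) t.
Proof. by elim: s p => [|r s ih] p /=; rewrite ?ih; ring. Qed.

(* the lower boundary is the graph over [p :: s], the upper one over [p :: t] *)
Lemma area_between S A p s t : convex2 S -> measurable A -> S `<=` A -> S p ->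
  (forall q, q \in s -> S q) -> (forall q, q \in t -> S q) ->
  path le_fst p s -> path le_fst p t -> last p s = last p t ->
  (((crosses p s - crosses p t) / 2)%:E <= mu2 A)%E.
Proof.
move=> cS mA SA Sp Ss St ps pt st.
have [gs Is] := graph_integral ps; have [gt It] := graph_integral pt.
set I := `[p.1, (last p s).1]%classic in gs Is.
have gI : mu.-integrable I (EFin \o graph p t) by rewrite /I st.
have -> : (crosses p s - crosses p t) / 2 = trapezoids p t - trapezoids p s.
  have := trapezoids_crosses p s; have := trapezoids_crosses p t; rewrite st.
  lra.
rewrite -Is -It -st -RintegralB //.
have mI : measurable (I : set (measurableTypeR R)) by exact: measurable_itv.
have gB := integrableB mI gI gs.
rewrite /Rintegral fineK; last exact: integrable_fin_num gB.
apply: (@le_trans _ _ (\int[mu]_(x in I) (mu \o xsection A) x)%E); last first.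
  apply: ge0_subset_integral => //; last exact: measurable_fun_xsection.
(* The negative part is dropped, so the two graphs may cross: where the intended upper graph is the
   lower one, the integrand is just bounded by 0. *)
rewrite integralE.
apply: (@le_trans _ _ (\int[mu]_(x in I) ((fun x => (graph p t x - graph p s x)%:E)^\+ x))%E).
  by rewrite -[leRHS]adde0 leeD2l // oppe_le0; apply: integral_ge0.
apply: ge0_le_integral => //.
- by apply: measurable_funepos; exact: measurable_int gB.
- by apply: measurable_funTS; exact: measurable_fun_xsection.
move=> x; rewrite /I /= in_itv /= => /andP[px xl].
rewrite funeposE ge_max measure_ge0 andbT.
have [gle|glt] := leP (graph p t x) (graph p s x).
  by apply: (@le_trans _ _ 0%E); [rewrite lee_fin subr_le0|exact: measure_ge0].
have -> : (graph p t x - graph p s x)%:E = mu `[graph p s x, graph p t x]%classic.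
  by rewrite lebesgue_measure_itv /= lte_fin glt.
apply: le_measure; rewrite ?inE //; first exact: measurable_xsection.
move=> y; rewrite /= in_itv /= => /andP[sy yt].
rewrite /xsection /= inE; apply: SA.
have Ss' := graph_mem cS Sp Ss ps px xl.
have St' : S (x, graph p t x) by apply: graph_mem; rewrite -?st.
pose u := (y - graph p s x) / (graph p t x - graph p s x).
have d0 : 0 < graph p t x - graph p s x by rewrite subr_gt0.
have -> : (x, y) = ((1 - u) * (x, graph p s x).1 + u * (x, graph p t x).1,
    (1 - u) * (x, graph p s x).2 + u * (x, graph p t x).2).
  by rewrite /u /=; congr (_, _); field; rewrite gt_eqF.
apply: cS => //; first by rewrite divr_ge0 ?subr_ge0 // ltW.
by rewrite ler_pdivrMr // mul1r lerD2r.
Qed.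

Lemma crossC p q : cross q p = - cross p q.
Proof. by rewrite /cross; ring. Qed.

Lemma le_fst_rcons p s q :
  path le_fst p (rcons s q) = path le_fst p s && ((last p s).1 <= q.1).
Proof. by rewrite rcons_path. Qed.

(** [area_between] needs two graphs with common ends. On the left and on the right, the end lying
    further out is added to the other list, which gives four cases; in each, the two closing edges
    enter with the sign of the shoelace formula. *)
Lemma area_two_chains S A a s c u : convex2 S -> measurable A -> S `<=` A ->
  (forall q, q \in a :: s -> S q) -> (forall q, q \in c :: u -> S q) ->
  path le_fst a s -> path le_fst c u ->
  (((crosses a s + cross (last a s) (last c u) - crosses c u + cross c a) / 2)%:E
     <= mu2 A)%E.
Proof.
move=> cS mA SA Ss Su ps pu.
have Sl : S (last a s) by apply/Ss/mem_last.
have Sr : S (last c u) by apply/Su/mem_last.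
have Sa : S a by apply: Ss; rewrite inE eqxx.
have Sc : S c by apply: Su; rewrite inE eqxx.
have Ss' q : q \in s -> S q by move=> qs; apply: Ss; rewrite inE qs orbT.
have Su' q : q \in u -> S q by move=> qs; apply: Su; rewrite inE qs orbT.
have Sl' q : q \in rcons s (last c u) -> S q.
  by rewrite mem_rcons inE => /predU1P[->//|]; exact: Ss'.
have Sr' q : q \in rcons u (last a s) -> S q.
  by rewrite mem_rcons inE => /predU1P[->//|]; exact: Su'.
have [r|r] := leP (last a s).1 (last c u).1; have [l|l] := leP c.1 a.1.
- have H := @area_between S A c (a :: rcons s (last c u)) u cS mA SA Sc.
  apply: le_trans (H _ Su' _ pu _); rewrite /= ?last_rcons //.
  + by rewrite crosses_rcons lee_fin; lra.
  + by move=> q; rewrite inE => /predU1P[->//|]; exact: Sl'.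
  + by rewrite le_fst_rcons ps r !andbT; exact: l.
- have H := @area_between S A a (rcons s (last c u)) (c :: u) cS mA SA Sa.
  apply: le_trans (H Sl' Su _ _ _); rewrite /= ?last_rcons //.
  + by rewrite crosses_rcons (crossC a c) lee_fin; lra.
  + by rewrite le_fst_rcons ps r.
  + by rewrite pu andbT; exact: ltW.
- have H := @area_between S A c (a :: s) (rcons u (last a s)) cS mA SA Sc.
  apply: le_trans (H Ss Sr' _ _ _); rewrite /= ?last_rcons //.
  + by rewrite crosses_rcons (crossC (last a s)) lee_fin; lra.
  + by rewrite ps !andbT; exact: l.
  + by rewrite le_fst_rcons pu ltW.
- have H := @area_between S A a s (c :: rcons u (last a s)) cS mA SA Sa.
  apply: le_trans (H Ss' _ ps _ _); rewrite /= ?last_rcons //.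
  + by rewrite crosses_rcons (crossC (last a s)) (crossC a c) lee_fin; lra.
  + by move=> q; rewrite inE => /predU1P[->//|]; exact: Sr'.
  + by rewrite le_fst_rcons pu (ltW r) !andbT; exact: ltW.
Qed.

Lemma crosses_rev p s : crosses (last p s) (rev (belast p s)) = - crosses p s.
Proof.
elim: s p => [|q s ih] p /=; first by rewrite oppr0.
rewrite rev_cons crosses_rcons ih.
have -> : last (last q s) (rev (belast q s)) = q.
  by case: s {ih} => //= r s; rewrite rev_cons last_rcons.
by rewrite (crossC p q); ring.
Qed.

Definition shoelace s : R := if s is p :: s' then crosses p (rcons s' p) else 0.

(* No order is required between the end of one list and the start of the other:
   such a pair of vertices extends whichever of the two graphs it can. *)
Lemma shoelace_area S A s t : convex2 S -> measurable A -> S `<=` A ->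
  s != [::] -> t != [::] -> (forall q, q \in s ++ t -> S q) ->
  sorted le_fst s -> sorted (fun p q => le_fst q p) t ->
  ((shoelace (s ++ t) / 2)%:E <= mu2 A)%E.
Proof.
case: s t => [|a s] // [|b t] // cS mA SA _ _ St /= ps pt.
have Ss q : q \in a :: s -> S q by move=> qs; apply: St; rewrite mem_cat qs.
have Su q : q \in last b t :: rev (belast b t) -> S q.
  move=> qt; apply: St; rewrite mem_cat; apply/orP; right.
  by rewrite -mem_rev lastI rev_rcons.
have pu : path le_fst (last b t) (rev (belast b t)) by rewrite rev_path.
apply: le_trans (area_two_chains cS mA SA Ss Su ps pu).
have -> : last (last b t) (rev (belast b t)) = b.
  by case: (t) => //= r t'; rewrite rev_cons last_rcons.
rewrite crosses_rev crosses_rcons crosses_cat last_cat /= lee_fin.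
by lra.
Qed.

End PolygonArea.

(** * An upper bound of pi *)

Section PiBound.
Variable R : realType.

Lemma ge0_derive_ge0 (f df : R -> R) : (forall x : R, is_derive x 1 f (df x)) ->
  0 <= f 0 -> (forall x : R, 0 <= x -> 0 <= df x) -> forall x : R, 0 <= x -> 0 <= f x.
Proof.
move=> dF f0 df0 x; rewrite le_eqVlt => /predU1P[<-//|x0].
have cF : {within `[0, x], continuous f}.
  apply: continuous_subspaceT => y; apply: differentiable_continuous.
  by apply/derivable1_diffP; case: (dF y).
have [c /[!in_itv]/= /andP[c0 _] fE] := MVT x0 (fun y _ => dF y) cF.
have -> : f x = f 0 + df c * (x - 0) by rewrite -fE; ring.
by rewrite addr_ge0 // mulr_ge0 ?subr0 ?df0 // ltW.
Qed.

(** Starting from 1 - cos y >= 0, each of the four remainders has the preceding one as its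
    derivative and vanishes at 0. *)
Lemma cos_le_Taylor4 (x : R) : 0 <= x ->
  cos x <= 1 - x ^+ 2 / 2 + x ^+ 4 / 24.
Proof.
have s1 : forall y : R, 0 <= y -> 0 <= y - sin y.
  apply: (@ge0_derive_ge0 (fun y : R => y - sin y) (fun y => 1 - cos y)).
  - by rewrite sin0 subrr.
  - by move=> z _; rewrite subr_ge0 cos_le1.
have c2 : forall y : R, 0 <= y -> 0 <= cos y - 1 + y ^+ 2 / 2.
  apply: (@ge0_derive_ge0 (fun y : R => cos y - 1 + y ^+ 2 / 2) (fun y => y - sin y)) => //.
  - move=> z; apply: is_derive_eq; rewrite /GRing.scale /=; by field.
  - by rewrite cos0; lra.
have s3 : forall y : R, 0 <= y -> 0 <= sin y - y + y ^+ 3 / 6.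
  apply: (@ge0_derive_ge0 (fun y : R => sin y - y + y ^+ 3 / 6) (fun y => cos y - 1 + y ^+ 2 / 2)) => //.
  - move=> z; apply: is_derive_eq; rewrite /GRing.scale /=; by field.
  - by rewrite sin0; lra.
move=> x0; rewrite -subr_ge0; move: x x0.
apply: (@ge0_derive_ge0 (fun y : R => 1 - y ^+ 2 / 2 + y ^+ 4 / 24 - cos y)
  (fun y => sin y - y + y ^+ 3 / 6)) => //.
- move=> z; apply: is_derive_eq; rewrite /GRing.scale /=; by field.
- by rewrite cos0; lra.
Qed.

(* With y = 3.1417 / 16, doubling the angle three times turns the Taylor bound
   into cos (3.1417 / 2) < 0. *)
Lemma pi_le : pi <= 3 + 1417 / 10 ^+ 4 :> R.
Proof.
rewrite leNgt; apply/negP => pi_gt.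
pose y : R := (3 + 1417 / 10 ^+ 4) / 16.
have cos_pos (k : R) : 0 <= k -> k <= 8 -> 0 < cos (k * y).
  move=> k0 k8; apply: cos_gt0_pihalf; rewrite /y; apply/andP; split; nra.
have dbl (k u : R) : 0 <= k -> k <= 4 -> cos (k * y) <= u ->
    cos (2 * k * y) <= 2 * u ^+ 2 - 1.
  move=> k0 k4 ku.
  have -> : 2 * k * y = (k * y) *+ 2 by ring.
  rewrite cos_mulr2n; have := cos_pos k k0 ltac:(lra); nra.
(* The bounds 0.9807841, 0.923875 and 0.7070905 are rounded up. The square of the last one is still
   below 1/2, so one more doubling gives a negative bound. *)
have c1 : cos (1 * y) <= (980 + 7841 / 10 ^+ 4) / 10 ^+ 3.
  by rewrite mul1r; apply: le_trans (cos_le_Taylor4 _) _; rewrite /y; lra.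
have c2 : cos (2 * y) <= (923 + 7 / 8) / 10 ^+ 3.
  by have := dbl 1 _ ler01 ltac:(lra) c1; rewrite mulr1; lra.
have c4 : cos (4 * y) <= (707 + 905 / 10 ^+ 4) / 10 ^+ 3.
  have := dbl 2 _ ltac:(lra) ltac:(lra) c2; have -> : 2 * 2 = 4 :> R by ring.
  lra.
have := dbl 4 _ ltac:(lra) ltac:(lra) c4; have -> : 2 * 4 = 8 :> R by ring.
have := cos_pos 8 ltac:(lra) ltac:(lra).
lra.
Qed.

End PiBound.

(** * Areas of polygons as polynomials in the placement *)

(* In this section and the next, lengths are integers in units of 10^-6. *)

Definition vec := (Z * Z)%type.

(* Identifying the plane with the complex numbers, a vertex stands for the point
   [fixed + turned * z + weight1 * t1 + weight2 * t2], where t1 is the centre of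
   the disc, t1 + t2 that of the triangle and the unit vector z points from the
   latter to a tip. *)
Record vertex := Vertex { fixed : vec; turned : vec; weight1 : Z; weight2 : Z }.

(* Twice the area of a polygon, as a polynomial in z, t1 and t2:
   [const + Im (coefz z) + Im ((coef1 + coef1z z^* ) t1)
    + Im ((coef2 + coef2z z^* ) t2) + coef12 (t1 x t2)]. *)
Record form := Form { const : Z; coefz : vec; coef1 : vec; coef1z : vec;
  coef2 : vec; coef2z : vec; coef12 : Z }.

Section Computation.
Local Open Scope Z_scope.

Definition addv (u v : vec) : vec := (u.1 + v.1, u.2 + v.2).
Definition subv (u v : vec) : vec := (u.1 - v.1, u.2 - v.2).
Definition scalev (k : Z) (u : vec) : vec := (k * u.1, k * u.2).
Definition conjv (u : vec) : vec := (u.1, - u.2).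
Definition mulv (u v : vec) : vec := (u.1 * v.1 - u.2 * v.2, u.1 * v.2 + u.2 * v.1).
Definition dotv (u v : vec) : Z := u.1 * v.1 + u.2 * v.2.
Definition crossv (u v : vec) : Z := u.1 * v.2 - u.2 * v.1.

Definition form0 := Form 0 (0, 0) (0, 0) (0, 0) (0, 0) (0, 0) 0.

Definition add_form (F G : form) : form :=
  Form (const F + const G) (addv (coefz F) (coefz G)) (addv (coef1 F) (coef1 G))
    (addv (coef1z F) (coef1z G)) (addv (coef2 F) (coef2 G))
    (addv (coef2z F) (coef2z G)) (coef12 F + coef12 G).

Definition scale_form (k : Z) (F : form) : form :=
  Form (k * const F) (scalev k (coefz F)) (scalev k (coef1 F))
    (scalev k (coef1z F)) (scalev k (coef2 F)) (scalev k (coef2z F)) (k * coef12 F).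

(** The cross product of p and q is the imaginary part of the conjugate of p times q, whence the
    conjugates. The turned parts contribute |z|^2 times the cross product of m and n; since |z| = 1
    this joins the constant, and the form stays linear in z and its conjugate. *)
Definition edge (P Q : vertex) : form :=
  let: Vertex p m a1 a2 := P in let: Vertex q n b1 b2 := Q in
  Form (crossv p q + crossv m n) (subv (mulv (conjv p) n) (mulv (conjv q) m))
    (subv (scalev b1 (conjv p)) (scalev a1 (conjv q)))
    (subv (scalev b1 (conjv m)) (scalev a1 (conjv n)))
    (subv (scalev b2 (conjv p)) (scalev a2 (conjv q)))
    (subv (scalev b2 (conjv m)) (scalev a2 (conjv n)))
    (a1 * b2 - a2 * b1).

Fixpoint edges (P : vertex) (s : seq vertex) : form :=
  if s is Q :: s' then add_form (edge P Q) (edges Q s') else form0.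

Definition polygon (s : seq vertex) : form :=
  if s is P :: s' then edges P (rcons s' P) else form0.

Definition min_linear (g : Z) (X : Z * Z) : Z := if 0 <=? g then g * X.1 else g * X.2.

Definition min_bilinear (g h n : Z) (X Y : Z * Z) : Z :=
  let v x y := g * x + h * y + n * (x * y) in
  Z.min (Z.min (v X.1 Y.1) (v X.1 Y.2)) (Z.min (v X.2 Y.1) (v X.2 Y.2)).

Record box := Box { rangea : Z * Z; rangeb : Z * Z; rangee : Z * Z; rangef : Z * Z }.

(** The four coordinates decouple: one summand involves only t1.1 and t2.2, another only t1.2 and
    t2.1. Each is affine in either variable, so two minima over four vertices replace one over
    sixteen. The factor h clears the denominators of z. *)
Definition min_form (B : box) (h : Z) (F : form) (z : vec) : Z :=
  let g1 := addv (scalev h (coef1 F)) (mulv (coef1z F) (conjv z)) in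
  let g2 := addv (scalev h (coef2 F)) (mulv (coef2z F) (conjv z)) in
  h * const F + (mulv (coefz F) z).2
  + min_bilinear g1.2 g2.1 (h * coef12 F) (rangea B) (rangef B)
  + min_bilinear g1.1 g2.2 (- (h * coef12 F)) (rangeb B) (rangee B).

(* No position in the box [B] puts [P] to the right of [Q]. *)
Definition left_of (B : box) (h : Z) (zs : seq vec) (P Q : vertex) : bool :=
  let: Vertex p m a1 a2 := P in let: Vertex q n b1 b2 := Q in
  let k := h * (q.1 - p.1 + min_linear (b1 - a1) (rangea B)
                 + min_linear (b2 - a2) (rangee B)) in
  all (fun z => 0 <=? k + (mulv (subv n m) z).1) zs.

End Computation.

(** * Real values of the integer forms and of their lower bounds *)

Section Soundness.
Variable R : realType.

Definition Zr (x : Z) : R := (int_of_Z x)%:~R.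

Lemma ZrD x y : Zr (Z.add x y) = Zr x + Zr y.
Proof. by rewrite /Zr (raddfD int_of_Z) rmorphD. Qed.
Lemma ZrN x : Zr (Z.opp x) = - Zr x.
Proof. by rewrite /Zr (raddfN int_of_Z) rmorphN. Qed.
Lemma ZrB x y : Zr (Z.sub x y) = Zr x - Zr y.
Proof. by rewrite /Zr (raddfB int_of_Z) rmorphB. Qed.
Lemma ZrM x y : Zr (Z.mul x y) = Zr x * Zr y.
Proof. by rewrite /Zr (rmorphM int_of_Z) rmorphM. Qed.
Lemma Zr0 : Zr Z0 = 0. Proof. by []. Qed.
Definition ZrE := (ZrD, ZrN, ZrB, ZrM, Zr0).

Lemma Zr_le x y : Z.le x y -> Zr x <= Zr y.
Proof. by move=> xy; rewrite /Zr ler_int; lia. Qed.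
Lemma Zr_lt x y : Z.lt x y -> Zr x < Zr y.
Proof. by move=> xy; rewrite /Zr ltr_int; lia. Qed.
Lemma Zr_geb0 x : Z.leb 0 x -> 0 <= Zr x.
Proof. by move/Z.leb_le/Zr_le. Qed.

Lemma Zr_ltb0 x : Z.ltb 0 x -> 0 < Zr x.
Proof. by move/Z.ltb_lt/Zr_lt. Qed.

Variables (t1 t2 z : R * R).
Hypothesis z1 : z.1 ^+ 2 + z.2 ^+ 2 = 1.

Definition position (P : vertex) : R * R :=
  let: Vertex p m a1 a2 := P in
  (Zr p.1 + (Zr m.1 * z.1 - Zr m.2 * z.2) + Zr a1 * t1.1 + Zr a2 * t2.1,
   Zr p.2 + (Zr m.1 * z.2 + Zr m.2 * z.1) + Zr a1 * t1.2 + Zr a2 * t2.2).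

(* homogeneous in [(h, w)], of which the intended value is [(1, z)] *)
Definition eval_form (F : form) (h : R) (w : R * R) : R :=
  h * Zr (const F) + (Zr (coefz F).1 * w.2 + Zr (coefz F).2 * w.1)
  + ((h * Zr (coef1 F).1 + Zr (coef1z F).1 * w.1 + Zr (coef1z F).2 * w.2) * t1.2
   + (h * Zr (coef1 F).2 + Zr (coef1z F).2 * w.1 - Zr (coef1z F).1 * w.2) * t1.1)
  + ((h * Zr (coef2 F).1 + Zr (coef2z F).1 * w.1 + Zr (coef2z F).2 * w.2) * t2.2
   + (h * Zr (coef2 F).2 + Zr (coef2z F).2 * w.1 - Zr (coef2z F).1 * w.2) * t2.1)
  + h * Zr (coef12 F) * (t1.1 * t2.2 - t1.2 * t2.1).

Lemma eval_form0 h w : eval_form form0 h w = 0.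
Proof. by rewrite /eval_form /= Zr0; ring. Qed.

Lemma eval_formD F G h w :
  eval_form (add_form F G) h w = eval_form F h w + eval_form G h w.
Proof. by rewrite /eval_form /add_form /addv /= !ZrE; ring. Qed.

Lemma eval_formZ k F h w : eval_form (scale_form k F) h w = Zr k * eval_form F h w.
Proof. by rewrite /eval_form /scale_form /scalev /= !ZrE; ring. Qed.

Lemma eval_edge P Q : let p := position P in let q := position Q in
  p.1 * q.2 - p.2 * q.1 = eval_form (edge P Q) 1 z.
Proof.
case: P Q => [[p1 p2] [m1 m2] a1 a2] [[q1 q2] [n1 n2] b1 b2].
rewrite /position /eval_form /edge /subv /scalev /mulv /conjv /crossv /= !ZrE.
apply/eqP; rewrite -subr_eq0; set e := (X in X == 0).
have -> : e = (Zr m1 * Zr n2 - Zr m2 * Zr n1) * (z.1 ^+ 2 + z.2 ^+ 2 - 1).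
  by rewrite /e; ring.
by rewrite z1 subrr mulr0.
Qed.

Lemma eval_edges P s :
  crosses (position P) (map position s) = eval_form (edges P s) 1 z.
Proof.
elim: s P => [|Q s ih] P /=; first by rewrite eval_form0.
by rewrite eval_formD ih -eval_edge.
Qed.

Lemma eval_polygon s : shoelace (map position s) = eval_form (polygon s) 1 z.
Proof.
case: s => [|P s] /=; first by rewrite eval_form0.
by rewrite -eval_edges map_rcons.
Qed.

Definition in_range (X : Z * Z) (x : R) := Zr X.1 <= x <= Zr X.2.

Lemma min_linear_le g X x : in_range X x -> Zr (min_linear g X) <= Zr g * x.
Proof.
case/andP => Xx xX; rewrite /min_linear; case: ifP => [/Zr_geb0 g0|/negbT g0].
  by rewrite ZrM ler_wpM2l.
have {}g0 : Zr g <= 0 by rewrite -Zr0; apply: Zr_le; lia.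
by rewrite ZrM ler_wnM2l.
Qed.

Lemma ge_min_affine (c g m x lo hi : R) : lo <= x <= hi ->
  m <= c + g * lo -> m <= c + g * hi -> m <= c + g * x.
Proof.
move=> /andP[h1 h2] m1 m2; have [g0|/ltW g0] := leP 0 g.
  by apply: le_trans m1 _; rewrite lerD2l ler_wpM2l.
by apply: le_trans m2 _; rewrite lerD2l ler_wnM2l.
Qed.

Lemma Zr_min x y : Zr (Z.min x y) = Num.min (Zr x) (Zr y).
Proof.
have [xy|xy] := Z.le_ge_cases x y.
  by rewrite Z.min_l // (min_idPl (Zr_le xy)).
by rewrite Z.min_r // (min_idPr (Zr_le xy)).
Qed.

Lemma min_bilinear_le g h n X Y x y : in_range X x -> in_range Y y ->
  Zr (min_bilinear g h n X Y) <= Zr g * x + Zr h * y + Zr n * (x * y).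
Proof.
move=> Xx Yy; rewrite /min_bilinear !Zr_min; set m := Num.min _ _.
have [m1 m2 m3 m4] : [/\ m <= Zr g * Zr X.1 + Zr h * Zr Y.1 + Zr n * (Zr X.1 * Zr Y.1),
  m <= Zr g * Zr X.1 + Zr h * Zr Y.2 + Zr n * (Zr X.1 * Zr Y.2),
  m <= Zr g * Zr X.2 + Zr h * Zr Y.1 + Zr n * (Zr X.2 * Zr Y.1) &
  m <= Zr g * Zr X.2 + Zr h * Zr Y.2 + Zr n * (Zr X.2 * Zr Y.2)].
  by split; rewrite -!ZrM -!ZrD /m !ge_min lexx ?orbT.
have side (u : R) : m <= Zr g * u + Zr h * Zr Y.1 + Zr n * (u * Zr Y.1) ->
    m <= Zr g * u + Zr h * Zr Y.2 + Zr n * (u * Zr Y.2) ->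
    m <= Zr g * u + Zr h * y + Zr n * (u * y).
  move=> mu1 mu2.
  have -> : Zr g * u + Zr h * y + Zr n * (u * y) = Zr g * u + (Zr h + Zr n * u) * y by ring.
  by apply: ge_min_affine Yy _ _; [move: mu1|move: mu2]; congr (_ <= _); ring.
have -> : Zr g * x + Zr h * y + Zr n * (x * y) = Zr h * y + (Zr g + Zr n * y) * x by ring.
apply: ge_min_affine Xx _ _.
  by have := side _ m1 m2; congr (_ <= _); ring.
by have := side _ m3 m4; congr (_ <= _); ring.
Qed.

Definition in_box (B : box) := [/\ in_range (rangea B) t1.1, in_range (rangeb B) t1.2,
  in_range (rangee B) t2.1 & in_range (rangef B) t2.2].

Lemma min_form_le B h F w : in_box B ->
  Zr (min_form B h F w) <= eval_form F (Zr h) (Zr w.1, Zr w.2).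
Proof.
case=> Ba Bb Be Bf; rewrite /min_form.
set g1 := addv _ _; set g2 := addv _ _.
have H1 := min_bilinear_le g1.2 g2.1 (Z.mul h (coef12 F)) Ba Bf.
have H2 := min_bilinear_le g1.1 g2.2 (Z.opp (Z.mul h (coef12 F))) Bb Be.
rewrite !ZrD; apply: le_trans (lerD (lerD (lexx _) H1) H2) _.
rewrite /g1 /g2 /addv /mulv /scalev /conjv /eval_form /= !ZrE le_eqVlt.
by apply/orP; left; apply/eqP; ring.
Qed.

End Soundness.

(** * Certificates *)

(* [Arc i k] consists of [k] consecutive disc points, starting with number [i]. *)
Inductive piece := Arc of nat & nat | Corner of nat | Tip of nat.

(* [with_tip] inserts the first tip of the triangle between the two right corners of
   the rectangle.  No position of the tip has to be checked: whenever it is to the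
   left of the corners, it decreases the area. *)
Record pattern := Pattern { weight : Z; lower : seq piece; with_tip : bool;
  upper : seq piece }.

(* A branching proof: [Cut i x] splits the range of the [i]th coordinate of (t1, t2)
   at [x], and [Turn] splits the range of directions of z; in a [Leaf], the weighted
   mean of the areas of some polygons exceeds the target. *)
Inductive certificate :=
  | Leaf of Z & seq pattern
  | Cut of nat & Z & certificate & certificate
  | Turn of Z & Z & certificate & certificate.

Section Check.
Local Open Scope Z_scope.

(* within the radius 159149, which is less than 10^6 / (2 pi) *)
Definition quadrant : seq vec := [:: (159149, 0); (158543, 13871); (156731, 27636);
  (153726, 41191); (149551, 54432); (144238, 67259); (137827, 79574);
  (130368, 91283); (121916, 102298); (112534, 112536); (102298, 121916);
  (91283, 130368); (79574, 137827); (67259, 144238); (54432, 149551);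
  (41191, 153726); (27636, 156731); (13871, 158543)].

(** 72 points in steps of 5 degrees, counterclockwise from the rightmost one. The list is doubled so
    that an arc may run past its starting point. *)
Definition disc_points : seq vec :=
  let q1 := [seq (- v.2, v.1) | v <- quadrant] in
  let q2 := [seq (- v.1, - v.2) | v <- quadrant] in
  let q3 := [seq (v.2, - v.1) | v <- quadrant] in
  let c := quadrant ++ q1 ++ q2 ++ q3 in c ++ c.

Definition corners : seq vec :=
  [:: (231250, 18750); (-231250, 18750); (-231250, -18750); (231250, -18750)].

(* approximations from inside of (sqrt 3 / 9) w for the cube roots of unity w *)
Definition tips : seq vec := [:: (192450, 0); (-96225, 166666); (-96225, -166666)].

Definition disc_vertex (v : vec) := Vertex v (0, 0) 1 0.
Definition corner_vertex (v : vec) := Vertex v (0, 0) 0 0.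
Definition tip_vertex (v : vec) := Vertex (0, 0) v 1 1.

(** Indices need no bounds check: the default values of [nth] are themselves a corner and a tip, and
    an arc that is too long is cut off by [take]. *)
Definition vertices_of (p : piece) : seq vertex :=
  match p with
  | Arc i k => [seq disc_vertex v | v <- take k (drop i disc_points)]
  | Corner i => [:: corner_vertex (nth (231250, 18750) corners i)]
  | Tip i => [:: tip_vertex (nth (192450, 0) tips i)]
  end.

Definition lower_right := corner_vertex (231250, -18750).
Definition upper_right := corner_vertex (231250, 18750).
Definition first_tip := tip_vertex (192450, 0).

Definition lower_chain (p : pattern) : seq vertex :=
  flatten (map vertices_of (lower p)) ++ (if with_tip p then [:: lower_right] else [::]).

Definition upper_chain (p : pattern) : seq vertex :=
  (if with_tip p then [:: upper_right] else [::]) ++ flatten (map vertices_of (upper p)).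

Definition outline (p : pattern) : seq vertex :=
  lower_chain p ++ (if with_tip p then [:: first_tip] else [::]) ++ upper_chain p.

Definition nonempty (s : seq vertex) : bool := if s is _ :: _ then true else false.

Definition check_pattern (B : box) (h : Z) (zs : seq vec) (p : pattern) : bool :=
  [&& 0 <? weight p, nonempty (lower_chain p), nonempty (upper_chain p),
      sorted (left_of B h zs) (lower_chain p) &
      sorted (fun P Q => left_of B h zs Q P) (upper_chain p)].

Definition total_form (s : seq pattern) : form :=
  foldr (fun p F => add_form (scale_form (weight p) (polygon (outline p))) F) form0 s.

Definition total_weight (s : seq pattern) : Z := foldr (fun p w => weight p + w) 0 s.

(* twice the area to be proved, in units of 10^-12 *)
Definition target : Z := 195 * 10 ^ 9.
(** [kz] is the scale of the direction vectors, [kk] that of the numbers k in the leaves. The latter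
    are about 10^6 / cos (half the angle of the arc), with a small margin for the rounding of the
    directions: 1154708 belongs to the full arc of 60 degrees. *)
Definition kz : Z := 10 ^ 5.
Definition kk : Z := 10 ^ 6.

(* [k / kk] bounds the norm of the tangents' intersection point over the arc from z0
   to z1, so that (1, z) is in the cone spanned by the [(h, w)] with [w] in [zs]. *)
Definition check_leaf (B : box) (z0 z1 : vec) (k : Z) (s : seq pattern) : bool :=
  let h := kz * kk in
  let zs := [:: scalev kk z0; scalev kk z1; scalev k z0; scalev k z1] in
  let F := total_form s in
  let V := h * (target * total_weight s) in
  [&& 0 <? crossv z0 z1, dotv z0 z1 <=? dotv z0 z0, dotv z0 z1 <=? dotv z1 z1, dotv z0 z0 <=? kz * kz, dotv z1 z1 <=? kz * kz, 0 <? k,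
      2 * (h * h) <=? k * k * (dotv z0 z0 + dotv z0 z1),
      2 * (h * h) <=? k * k * (dotv z1 z1 + dotv z0 z1),
      0 <? total_weight s, all (check_pattern B h zs) s &
      all (fun z => V <=? min_form B h F z) zs].

Fixpoint check (B : box) (z0 z1 : vec) (t : certificate) : bool :=
  match t with
  | Leaf k s => check_leaf B z0 z1 k s
  | Cut i x t1 t2 =>
      let: Box a b e f := B in
      let: (B1, B2) := match i with
        | 0%nat => (Box (a.1, x) b e f, Box (x, a.2) b e f)
        | 1%nat => (Box a (b.1, x) e f, Box a (x, b.2) e f)
        | 2%nat => (Box a b (e.1, x) f, Box a b (x, e.2) f)
        | _ => (Box a b e (f.1, x), Box a b e (x, f.2))
        end in
      check B1 z0 z1 t1 && check B2 z0 z1 t2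
  | Turn x y t1 t2 => check B z0 (x, y) t1 && check B (x, y) z1 t2
  end.

(** t2 is the difference of two centres, both confined like t1; hence its ranges are twice as
    long. *)
Definition whole_box : box := Box (-6000000, 6000000) (-500000, 500000)
  (-12000000, 12000000) (-1000000, 1000000).

End Check.

(** * Enclosing an arc of the unit circle in a polyhedral cone *)

Section Cone.
Variable R : realType.

(* z is a combination of a and b with coefficients of sum s / K, where
   1 <= s <= k / L because a and b have length about K and z has length 1. *)
Lemma cone_hull (K L k g : R) (a b z u : R * R) :
  0 < K -> 0 < L -> 0 < k -> 0 < cross a b -> 0 <= cross a z -> 0 <= cross z b ->
  z.1 ^+ 2 + z.2 ^+ 2 = 1 ->
  a.1 * b.1 + a.2 * b.2 <= a.1 * a.1 + a.2 * a.2 ->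
  a.1 * b.1 + a.2 * b.2 <= b.1 * b.1 + b.2 * b.2 ->
  a.1 * a.1 + a.2 * a.2 <= K * K -> b.1 * b.1 + b.2 * b.2 <= K * K ->
  2 * (K * L * (K * L)) <= k * k * (a.1 * a.1 + a.2 * a.2 + (a.1 * b.1 + a.2 * b.2)) ->
  2 * (K * L * (K * L)) <= k * k * (b.1 * b.1 + b.2 * b.2 + (a.1 * b.1 + a.2 * b.2)) ->
  0 <= K * L * g + L * (u.1 * a.1 + u.2 * a.2) ->
  0 <= K * L * g + L * (u.1 * b.1 + u.2 * b.2) ->
  0 <= K * L * g + k * (u.1 * a.1 + u.2 * a.2) ->
  0 <= K * L * g + k * (u.1 * b.1 + u.2 * b.2) ->
  0 <= g + u.1 * z.1 + u.2 * z.2.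
Proof.
move=> K0 L0 k0 D0 az zb z1 da db aK bK.
set qa := a.1 * a.1 + _ in da aK *; set qb := b.1 * b.1 + _ in db bK *; set d := a.1 * b.1 + _ in da db *.
set Ga := u.1 * a.1 + _; set Gb := u.1 * b.1 + _ => ka kb Ha Hb Hka Hkb.
pose al := cross z b / cross a b; pose be := cross a z / cross a b.
have al0 : 0 <= al by rewrite divr_ge0 // ltW.
have be0 : 0 <= be by rewrite divr_ge0 // ltW.
have D_neq0 : cross a b != 0 by rewrite gt_eqF.
have alD : al * cross a b = cross z b by rewrite /al divfK.
have beD : be * cross a b = cross a z by rewrite /be divfK.
have zE1 : z.1 = al * a.1 + be * b.1.
  apply: (mulIf D_neq0); transitivity (al * cross a b * a.1 + be * cross a b * b.1); last by ring.
  by rewrite alD beD /cross; ring.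
have zE2 : z.2 = al * a.2 + be * b.2.
  apply: (mulIf D_neq0); transitivity (al * cross a b * a.2 + be * cross a b * b.2); last by ring.
  by rewrite alD beD /cross; ring.
have norm : al ^+ 2 * qa + be ^+ 2 * qb + 2 * (al * be) * d = 1.
  by rewrite -[RHS]z1 zE1 zE2 /qa /qb /d; ring.
pose s := (al + be) * K.
have ab0 : 0 <= al * be by apply: mulr_ge0.
(* The squared length of z is a quadratic form in al and be whose coefficients are at most those of
   K^2 (al + be)^2. *)
have s1 : 1 <= s.
  have : 1 <= s ^+ 2.
    rewrite -[leLHS]norm /s; have -> : ((al + be) * K) ^+ 2 = al ^+ 2 * (K * K) + be ^+ 2 * (K * K) + 2 * (al * be) * (K * K) by ring.
    apply: lerD; first by apply: lerD; rewrite ler_wpM2l // sqr_ge0.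
    by apply: ler_wpM2l; [rewrite mulr_ge0|exact: le_trans da aK].
  by rewrite -{1}(expr1n _ 2) ler_pXn2r // nnegrE ?ler01 // /s mulr_ge0 ?addr_ge0 // ltW.
(* With q = min (qa, qb) >= d, the squared length 1 of z is at least (al + be)^2 (q + d) / 2 + (al -
   be)^2 (q - d) / 2; the second term is dropped. *)
have sk : s * L <= k.
  have h1 : (al + be) ^+ 2 * (2 * (K * L * (K * L))) <= 2 * (k * k).
    suff q_le q : q <= qa -> q <= qb -> d <= q -> 2 * (K * L * (K * L)) <= k * k * (q + d) ->
        (al + be) ^+ 2 * (2 * (K * L * (K * L))) <= 2 * (k * k).
      by have [qab|/ltW qab] := leP qa qb; [exact: q_le ka|exact: q_le kb].
    move=> qa_le qb_le dq kq; apply: le_trans (ler_wpM2l (sqr_ge0 _) kq) _.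
    have : 0 <= k * k * ((al - be) ^+ 2 * (q - d) + 2 * (al ^+ 2 * (qa - q)) + 2 * (be ^+ 2 * (qb - q))).
      apply: mulr_ge0; first by rewrite mulr_ge0 // ltW.
      have e1 : 0 <= (al - be) ^+ 2 * (q - d) by rewrite mulr_ge0 ?sqr_ge0 ?subr_ge0.
      have e2 : 0 <= al ^+ 2 * (qa - q) by rewrite mulr_ge0 ?sqr_ge0 ?subr_ge0.
      have e3 : 0 <= be ^+ 2 * (qb - q) by rewrite mulr_ge0 ?sqr_ge0 ?subr_ge0.
      by lra.
    have -> : k * k * ((al - be) ^+ 2 * (q - d) + 2 * (al ^+ 2 * (qa - q)) + 2 * (be ^+ 2 * (qb - q)))
      = 2 * (k * k) * (al ^+ 2 * qa + be ^+ 2 * qb + 2 * (al * be) * d) - (al + be) ^+ 2 * (k * k * (q + d)) by ring.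
    by rewrite norm mulr1 subr_ge0.
  have : (s * L) ^+ 2 <= k ^+ 2 by rewrite /s !expr2; move: h1; rewrite expr2; lra.
  by rewrite ler_pXn2r // nnegrE ?(ltW k0) // mulr_ge0 ?(ltW L0) // /s mulr_ge0 ?addr_ge0 // ltW.
(* An affine function that is nonnegative at L and at k is nonnegative at s L, which lies between
   them. *)
have aff (G : R) : 0 <= K * L * g + L * G -> 0 <= K * L * g + k * G -> 0 <= K * g + s * G.
  move=> G1 G2; have sL : L <= s * L <= k by rewrite sk ler_peMl // ltW.
  have : 0 <= K * L * g + G * (s * L) by apply: ge_min_affine sL _ _; rewrite [G * _]mulrC.
  have -> : K * L * g + G * (s * L) = L * (K * g + s * G) by ring.
  by rewrite pmulr_rge0.
have A := mulr_ge0 al0 (aff _ Ha Hka); have B := mulr_ge0 be0 (aff _ Hb Hkb).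
have : 0 <= s * (g + u.1 * z.1 + u.2 * z.2).
  have -> : s * (g + u.1 * z.1 + u.2 * z.2) = al * (K * g + s * Ga) + be * (K * g + s * Gb).
    by rewrite zE1 zE2 /Ga /Gb /s; ring.
  exact: addr_ge0.
by rewrite pmulr_rge0 //; lra.
Qed.
End Cone.

(** * Bounds on the area of one polygon and on weighted means of such areas *)

Section CheckSoundness.
Variable R : realType.
Local Notation Zr := (@Zr R).

(** The term in parentheses is twice the signed area of the triangle p q r. *)
Lemma shoelace_insert (s t : seq (R * R)) p q r :
  shoelace (s ++ p :: q :: r :: t) =
  shoelace (s ++ p :: r :: t) + (cross p q + cross q r - cross p r).
Proof.
case: s => [|a s] /=; first by ring.
by rewrite !rcons_cat !crosses_cat /=; ring.
Qed.

Variables (t1 t2 z : R * R).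
Hypothesis z1 : z.1 ^+ 2 + z.2 ^+ 2 = 1.
Local Notation position := (position t1 t2 z).
Local Notation eval_form := (eval_form t1 t2).

Variables (h : Z) (zs : seq vec).

(* [(1, z)] belongs to the convex cone spanned by the [(h, w)], w in [zs] *)
Hypothesis hull : forall (g : R) (u : R * R),
  (forall w, w \in zs -> 0 <= Zr h * g + u.1 * Zr w.1 + u.2 * Zr w.2) ->
  0 <= g + u.1 * z.1 + u.2 * z.2.

Variable B : box.
Hypothesis tB : in_box t1 t2 B.

Lemma left_of_sound P Q : left_of B h zs P Q -> le_fst (position P) (position Q).
Proof.
case: P Q => [[p1 p2] [m1 m2] a1 a2] [[q1 q2] [n1 n2] b1 b2] /= /allP zsP.
case: tB => Ba _ Be _.
have La := min_linear_le (Z.sub b1 a1) Ba; have Le := min_linear_le (Z.sub b2 a2) Be.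
set la := min_linear _ _ in zsP La; set le := min_linear _ _ in zsP Le.
have : 0 <= Zr (Z.add (Z.add (Z.sub q1 p1) la) le) +
    (Zr (Z.sub n1 m1), - Zr (Z.sub n2 m2)).1 * z.1 +
    (Zr (Z.sub n1 m1), - Zr (Z.sub n2 m2)).2 * z.2.
  apply: hull => w /zsP /= /Zr_geb0 => /(_ R); rewrite !ZrE; lra.
rewrite /le_fst /= !ZrE; rewrite !ZrE in La Le; lra.
Qed.

Lemma sorted_position (e : rel vertex) (r : rel (R * R)) s :
  (forall P Q, e P Q -> r (position P) (position Q)) ->
  sorted e s -> sorted r (map position s).
Proof. by move=> er; rewrite sorted_map; apply: sub_sorted => P Q; exact: er. Qed.

(** [St] stands for S in integer units. [St_shoelace] expresses the assumption to be refuted, that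
    the area of S is below the target. *)
Variable St : R * R -> Prop.
Hypothesis St_piece : forall p q, q \in map position (vertices_of p) -> St q.
Hypothesis St_shoelace : forall s t : seq (R * R), s != [::] -> t != [::] ->
  (forall q, q \in s ++ t -> St q) ->
  sorted (@le_fst R) s -> sorted (fun p q => le_fst q p) t ->
  shoelace (s ++ t) < Zr target.

Lemma St_pieces s q : q \in map position (flatten (map vertices_of s)) -> St q.
Proof.
elim: s => [|p s ih] //=; rewrite map_cat mem_cat => /orP[|]; last exact: ih.
exact: St_piece.
Qed.

Lemma sorted_cat2 (T : Type) (e : rel T) s p q :
  sorted e (s ++ [:: p]) -> e p q -> sorted e (s ++ [:: p; q]).
Proof.
case: s => [|a s] /=; first by rewrite andbT.
by rewrite !cat_path /= !andbT => /andP[-> ->].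
Qed.

Lemma position_corner v : position (corner_vertex v) = (Zr v.1, Zr v.2).
Proof. by rewrite /position /= !Zr0; congr (_, _); ring. Qed.

Lemma pattern_sound p : check_pattern B h zs p ->
  eval_form (polygon (outline p)) 1 z < Zr target.
Proof.
case/and5P => _ lne une lsort usort.
have {}lsort := sorted_position left_of_sound lsort.
have {}usort : sorted (fun p q => le_fst q p) (map position (upper_chain p)).
  by apply: sorted_position usort => P Q; exact: left_of_sound.
have St_lower q : q \in map position (lower_chain p) -> St q.
  rewrite /lower_chain map_cat mem_cat => /orP[|]; first exact: St_pieces.
  by case: with_tip => //; exact: (@St_piece (Corner 3)).
have St_upper q : q \in map position (upper_chain p) -> St q.
  rewrite /upper_chain map_cat mem_cat => /orP[|]; last exact: St_pieces.
  by case: with_tip => //; exact: (@St_piece (Corner 0)).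
have ne s : nonempty s -> map position s != [::] by case: s.
have base : shoelace (map position (lower_chain p) ++ map position (upper_chain p)) < Zr target.
  apply: St_shoelace => //; try exact: ne.
  by move=> q; rewrite mem_cat => /orP[]; [exact: St_lower|exact: St_upper].
rewrite -(eval_polygon _ _ z1) /outline map_cat [map position ((if _ then _ else _) ++ _)]map_cat.
case tip : (with_tip p); last exact: base.
move: base lsort usort St_lower St_upper; rewrite /lower_chain /upper_chain tip !map_cat.
set lo := map position (flatten (map vertices_of (lower p))).
set up := map position (flatten (map vertices_of (upper p))).
have map1 P : map position [:: P] = [:: position P] by [].
rewrite !map1 -!catA !cat1s.
move=> base lsort usort St_lower St_upper.
have St_tip : St (position first_tip) by apply: (@St_piece (Tip 0)); rewrite inE.
(* A tip to the right of the corners can end the lower chain, and its order relative to the start of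
   the upper chain is immaterial. Otherwise the chains are used without it, and inserting it adds 2
   Y (q.1 - X) <= 0. *)
have [right|left] := leP (position lower_right).1 (position first_tip).1.
  rewrite -[_ :: _ :: _ :: up]/([:: position lower_right; position first_tip] ++ (position upper_right :: up)) catA.
  apply: St_shoelace => //; first by case: (lo).
  - move=> q; rewrite mem_cat => /orP[|]; last exact: St_upper.
    rewrite mem_cat => /orP[qlo|]; first by apply: St_lower; rewrite mem_cat qlo.
    rewrite !inE => /orP[/eqP->|/eqP->//].
    by apply: St_lower; rewrite mem_cat inE eqxx orbT.
  - exact: sorted_cat2.
rewrite shoelace_insert; apply: le_lt_trans base.
pose X := Zr (fixed upper_right).1; pose Y := Zr (fixed upper_right).2.
have Y0 : 0 <= Y by exact: Zr_geb0.
have lrE : position lower_right = (X, - Y) by rewrite position_corner /Y -ZrN.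
have urE : position upper_right = (X, Y) by rewrite position_corner.
rewrite lrE urE in left *; set q := position first_tip in left *.
clearbody X Y q; rewrite gerDl /cross /=; have -> : X * q.2 - - Y * q.1 + (q.1 * Y - q.2 * X) - (X * Y - - Y * X)
  = 2 * Y * (q.1 - X) by ring.
by apply: mulr_ge0_le0; [rewrite mulr_ge0|rewrite subr_le0 ltW].
Qed.

(** Linearity in (k, w), in the shape in which [hull] can be applied. *)
Lemma eval_formE F k (w : R * R) : eval_form F k w =
  k * eval_form F 1 (0, 0) + (eval_form F 0 (1, 0)) * w.1 + (eval_form F 0 (0, 1)) * w.2.
Proof. by rewrite /eval_form /=; ring. Qed.

(** Strictness comes from the first pattern, which has positive weight; the list is not empty
    because its total weight is positive. *)
Lemma eval_total s : all (check_pattern B h zs) s -> Z.ltb 0 (total_weight s) ->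
  eval_form (total_form s) 1 z < Zr target * Zr (total_weight s).
Proof.
have nonstrict s' : all (check_pattern B h zs) s' ->
    eval_form (total_form s') 1 z <= Zr target * Zr (total_weight s').
  elim: s' => [|p s' ih] /=; first by rewrite eval_form0 Zr0 mulr0.
  case/andP => ps /ih ih'; rewrite eval_formD eval_formZ ZrD [Zr target * _]mulrDr lerD //.
  rewrite mulrC ler_wpM2r //; last exact/ltW/pattern_sound.
  by case/and5P: ps => w0 _ _ _ _; apply: Zr_geb0; lia.
case: s => [|p s] //= /andP[ps /nonstrict ns] _.
rewrite eval_formD eval_formZ ZrD [Zr target * _]mulrDr ltr_leD //.
rewrite mulrC ltr_pM2r; first exact: pattern_sound.
by case/and5P: ps => w0 _ _ _ _; apply: Zr_ltb0.
Qed.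

End CheckSoundness.

(** * A valid certificate excludes all placements in its box and sector *)

Section CertificateSoundness.
Variable R : realType.
Local Notation Zr := (@Zr R).
Variables (t1 t2 z : R * R).
Hypothesis znorm : z.1 ^+ 2 + z.2 ^+ 2 = 1.
Local Notation position := (position t1 t2 z).
Variable St : R * R -> Prop.
Hypothesis St_piece : forall p q, q \in map position (vertices_of p) -> St q.
Hypothesis St_shoelace : forall s t : seq (R * R), s != [::] -> t != [::] ->
  (forall q, q \in s ++ t -> St q) ->
  sorted (@le_fst R) s -> sorted (fun p q => le_fst q p) t ->
  shoelace (s ++ t) < Zr target.

Definition real_vec (v : vec) : R * R := (Zr v.1, Zr v.2).

Lemma check_leaf_sound B z0 z1 k s : in_box t1 t2 B ->
  0 <= cross (real_vec z0) z -> 0 <= cross z (real_vec z1) ->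
  check_leaf B z0 z1 k s -> False.
Proof.
move=> tB cz0 cz1; rewrite /check_leaf.
have kz0 : 0 < Zr kz by apply: Zr_ltb0.
have kk0 : 0 < Zr kk by apply: Zr_ltb0.
(* Only the positivity of the two scales matters from here on; as variables they are never
   unfolded. *)
move: kz kk kz0 kk0 => K L K0 L0; set h := Z.mul K L.
case/and5P => D0 d0 d1 n0 /and5P[n1 k0 q0 q1 /and3P[w0 ps Fs]].
set zs := [:: _; _; _; _] in ps Fs.
have h0 : 0 < Zr h by rewrite /h ZrM mulr_gt0.
have hull (g : R) (u : R * R) :
    (forall w, w \in zs -> 0 <= Zr h * g + u.1 * Zr w.1 + u.2 * Zr w.2) ->
    0 <= g + u.1 * z.1 + u.2 * z.2.
  move=> H.
  have [H1 H2 H3 H4] : [/\ 0 <= Zr h * g + u.1 * Zr (scalev L z0).1 + u.2 * Zr (scalev L z0).2,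
    0 <= Zr h * g + u.1 * Zr (scalev L z1).1 + u.2 * Zr (scalev L z1).2,
    0 <= Zr h * g + u.1 * Zr (scalev k z0).1 + u.2 * Zr (scalev k z0).2 &
    0 <= Zr h * g + u.1 * Zr (scalev k z1).1 + u.2 * Zr (scalev k z1).2].
    by split; apply: H; rewrite /zs !inE eqxx ?orbT.
  move: H1 H2 H3 H4; rewrite /scalev /= !ZrM => H1 H2 H3 H4.
  have toR x y : Z.leb x y -> Zr x <= Zr y by move/Z.leb_le/Zr_le.
  have toRlt x y : Z.ltb x y -> Zr x < Zr y by move/Z.ltb_lt/Zr_lt.
  move/toRlt: D0; move/toR: d0; move/toR: d1; move/toR: n0; move/toR: n1.
  move/toRlt: k0; move/toR: q0; move/toR: q1.
  rewrite /crossv /dotv !ZrE.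
  have -> : Zr 2 = 2 by [].
  move=> q1 q0 k0 n1 n0 d1 d0 D0.
  apply: (@cone_hull _ (Zr K) (Zr L) (Zr k) g (real_vec z0) (real_vec z1)) => //;
    rewrite /real_vec /cross /=; lra.
have := eval_total znorm hull tB St_piece St_shoelace ps w0.
set F := total_form s in Fs *; set W := total_weight s in Fs *.
have {Fs} FW w : w \in zs -> Zr h * (Zr target * Zr W) <= eval_form t1 t2 F (Zr h) (real_vec w).
  move=> wz; apply: le_trans (min_form_le h F w tB).
  by rewrite -!ZrM; apply/Zr_le/Z.leb_le; exact: (allP Fs).
move: FW; rewrite [eval_form _ _ F 1 z]eval_formE => FW.
set TW := Zr target * Zr W; rewrite ltNge => /negP; apply.
(* The lower bound, checked by computation at the generators in [zs], passes to the true direction z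
   and contradicts the strict upper bound of [eval_total]. *)
have := hull (eval_form t1 t2 F 1 (0, 0) - TW)
  (eval_form t1 t2 F 0 (1, 0), eval_form t1 t2 F 0 (0, 1)).
have {}FW w : w \in zs -> Zr h * TW <= Zr h * eval_form t1 t2 F 1 (0, 0) +
    eval_form t1 t2 F 0 (1, 0) * Zr w.1 + eval_form t1 t2 F 0 (0, 1) * Zr w.2.
  by move=> /FW; rewrite eval_formE.
move: TW (eval_form t1 t2 F 1 (0, 0)) (eval_form t1 t2 F 0 (1, 0)) (eval_form t1 t2 F 0 (0, 1)) FW.
move=> TW g u1 u2 FW /= H; suff : 0 <= g - TW + u1 * z.1 + u2 * z.2 by lra.
by apply: H => w /FW; lra.
Qed.

Lemma check_sound t B z0 z1 : in_box t1 t2 B ->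
  0 <= cross (real_vec z0) z -> 0 <= cross z (real_vec z1) ->
  check B z0 z1 t -> False.
Proof.
elim: t B z0 z1 => [k s|i x c1 ih1 c2 ih2|x y c1 ih1 c2 ih2] B z0 z2 tB cz0 cz2 /=.
- exact: check_leaf_sound.
- case: B tB => a b e f [/= Ba Bb Be Bf].
  have split_range (X : Z * Z) (u : R) : in_range X u -> in_range (X.1, x) u \/ in_range (x, X.2) u.
    move=> /andP[Xu uX]; have [ux|/ltW xu] := leP u (Zr x).
      by left; rewrite /in_range /= Xu.
    by right; rewrite /in_range /= xu.
  case: i => [|[|[|i]]] /andP[h1 h2].
  + by case: (split_range _ _ Ba) => ?; [apply: ih1 h1|apply: ih2 h2].
  + by case: (split_range _ _ Bb) => ?; [apply: ih1 h1|apply: ih2 h2].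
  + by case: (split_range _ _ Be) => ?; [apply: ih1 h1|apply: ih2 h2].
  + by case: (split_range _ _ Bf) => ?; [apply: ih1 h1|apply: ih2 h2].
case/andP => h1 h2; have [c|/ltW c] := leP 0 (cross (real_vec (x, y)) z).
  exact: ih2 h2.
by apply: ih1 h1 => //; rewrite crossC oppr_ge0.
Qed.

End CertificateSoundness.

(** * The certificate and its verification *)

Section Data.
Local Open Scope Z_scope.
(* found by branch and bound, each leaf by solving a linear program for the weights *)
Definition the_certificate : certificate :=
Cut 0 (300000)
  (Cut 0 (-93750)
  (Leaf 1154708 [:: Pattern 10000 [:: Arc 36 19; Corner 3; Corner 0] false [:: Arc 18 18]])
  (Cut 0 (103125)
  (Cut 2 (600000)
  (Cut 2 (-581250)
  (Leaf 1154708 [:: Pattern 10000 [:: Tip 2; Arc 54 9; Corner 3; Corner 0] false [:: Arc 10 9; Tip 1]])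
  (Cut 1 (200000)
  (Cut 1 (-62500)
  (Leaf 1154708 [:: Pattern 10000 [:: Corner 1; Corner 2; Arc 44 21; Corner 3; Corner 0] false [:: Arc 14 9]])
  (Cut 1 (68750)
  (Cut 3 (400000)
  (Cut 3 (-300000)
  (Leaf 1154708 [:: Pattern 2212 [:: Tip 2] false [:: Corner 3; Arc 8 18; Corner 1];
    Pattern 3691 [:: Tip 1; Tip 0] false [:: Corner 3; Arc 9 21; Corner 1];
    Pattern 4097 [:: Tip 2; Tip 0] false [:: Corner 0; Arc 10 18; Corner 2]])
  (Cut 2 (245625)
  (Cut 2 (-333188)
  (Leaf 1154708 [:: Pattern 10000 [:: Tip 2; Arc 53 10; Corner 3; Corner 0] false [:: Arc 10 8; Tip 1]])
  (Cut 3 (190000)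
  (Cut 3 (-153000)
  (Leaf 1154708 [:: Pattern 8163 [:: Tip 2] false [:: Corner 3; Arc 9 21; Corner 1];
    Pattern 1837 [:: Tip 2; Tip 0] false [:: Corner 0; Arc 10 17; Corner 1]])
  (Cut 2 (-159544)
  (Leaf 1154708 [:: Pattern 6127 [:: Tip 2; Arc 52 21] false [:: Arc 1 15; Tip 1];
    Pattern 3873 [:: Tip 2; Arc 58 15] false [:: Arc 1 22; Tip 1]])
  (Turn 100000 (0)
  (Cut 3 (87100)
  (Cut 3 (-80970)
  (Leaf 1035284 [:: Pattern 3013 [:: Tip 2] false [:: Corner 3; Arc 10 20; Corner 1];
    Pattern 6987 [:: Tip 2; Tip 0] false [:: Corner 3; Arc 11 19; Corner 1]])
  (Turn 96592 (-25881)
  (Cut 2 (124074)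
  (Cut 3 (36679)
  (Cut 2 (-74459)
  (Leaf 1008639 [:: Pattern 3992 [:: Corner 1; Corner 2; Arc 51 9; Corner 3; Corner 0] false [:: Arc 8 9; Tip 1];
    Pattern 4884 [:: Tip 2; Arc 53 7; Corner 3; Corner 0] false [:: Arc 8 20; Corner 1];
    Pattern 391 [:: Tip 2; Arc 52 21] false [:: Corner 0; Arc 12 10; Corner 1];
    Pattern 733 [:: Tip 2; Arc 53 10; Corner 3; Corner 0] false [:: Arc 10 8; Tip 1]])
  (Cut 3 (-45675)
  (Leaf 1008639 [:: Pattern 8286 [:: Tip 2; Arc 54 3; Tip 0] false [:: Corner 0; Arc 9 21; Corner 2];
    Pattern 1149 [:: Tip 2; Arc 54 5; Corner 3; Corner 0] false [:: Arc 8 21; Corner 1];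
    Pattern 565 [:: Tip 2; Arc 54 4; Corner 3; Corner 0] false [:: Arc 10 27]])
  (Turn 92387 (-38268)
  (Cut 2 (74441)
  (Leaf 1002156 [:: Pattern 2927 [:: Corner 1; Corner 2; Arc 48 12; Corner 3; Corner 0] false [:: Arc 9 3; Tip 1; Arc 26 3];
    Pattern 851 [:: Tip 2; Arc 49 10; Tip 0] false [:: Corner 0; Arc 9 3; Tip 1; Arc 26 2; Corner 1];
    Pattern 1660 [:: Tip 2; Arc 51 8; Tip 0] false [:: Corner 0; Arc 9 4; Tip 1; Arc 26 4; Corner 1];
    Pattern 1848 [:: Corner 1; Corner 2; Arc 49 11; Corner 3; Corner 0] false [:: Arc 8 5; Tip 1; Arc 26 3];
    Pattern 2714 [:: Tip 2; Arc 50 8; Tip 0] false [:: Corner 0; Arc 8 4; Tip 1; Arc 26 4; Corner 2]])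
  (Leaf 1002156 [:: Pattern 1120 [:: Corner 2; Tip 2; Arc 53 3; Tip 0] false [:: Corner 0; Arc 10 27];
    Pattern 8880 [:: Corner 1; Corner 2; Arc 47 11; Tip 0] false [:: Corner 0; Tip 1; Arc 21 6]]))
  (Cut 0 (4687)
  (Cut 2 (24807)
  (Cut 2 (6195)
  (Leaf 1002156 [:: Pattern 4705 [:: Corner 1; Corner 2; Arc 48 13; Corner 3; Corner 0] false [:: Arc 9 6; Tip 1; Arc 29 1];
    Pattern 119 [:: Tip 2; Arc 51 10; Corner 3; Corner 0] false [:: Arc 8 6; Tip 1; Corner 1];
    Pattern 5176 [:: Tip 2; Arc 52 9; Tip 0; Corner 3; Corner 0] false [:: Arc 8 7; Tip 1; Arc 29 1; Corner 1]])
  (Leaf 1002156 [:: Pattern 3474 [:: Corner 1; Corner 2; Arc 47 13; Corner 3; Corner 0] false [:: Arc 10 4; Tip 1; Arc 25 5];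
    Pattern 4378 [:: Tip 2; Arc 52 8; Tip 0; Corner 3; Corner 0] false [:: Arc 8 6; Tip 1; Arc 24 6; Corner 2];
    Pattern 2148 [:: Corner 1; Corner 2; Arc 47 15; Corner 3; Corner 0] false [:: Arc 9 3; Tip 1; Arc 26 1]]))
  (Leaf 1002156 [:: Pattern 3011 [:: Corner 1; Corner 2; Arc 47 13; Corner 3; Corner 0] false [:: Arc 9 2; Tip 1; Arc 25 5];
    Pattern 4182 [:: Corner 1; Corner 2; Tip 2; Arc 54 7; Tip 0] false [:: Corner 0; Arc 10 1; Tip 1; Arc 25 5];
    Pattern 2355 [:: Corner 1; Corner 2; Arc 43 1; Tip 2; Arc 54 6; Corner 3; Corner 0] false [:: Arc 9 2; Tip 1; Arc 24 6];
    Pattern 453 [:: Corner 1; Corner 2; Arc 47 13; Corner 3; Corner 0] false [:: Arc 10 1; Tip 1; Arc 25 5]]))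
  (Leaf 1002156 [:: Pattern 3500 [:: Corner 1; Corner 2; Arc 49 12] true [:: Arc 8 3; Tip 1; Arc 29 1];
    Pattern 835 [:: Corner 1; Corner 2; Arc 49 11] true [:: Arc 8 21];
    Pattern 106 [:: Corner 1; Corner 2; Arc 49 11; Tip 0] false [:: Arc 10 1; Tip 1; Arc 29 1];
    Pattern 5559 [:: Corner 1; Corner 2; Tip 2; Arc 54 7; Tip 0] false [:: Corner 0; Arc 9 2; Tip 1; Arc 29 1]])))))
  (Leaf 1008639 [:: Pattern 290 [:: Corner 1; Corner 2; Arc 49 9; Corner 3; Corner 0] false [:: Arc 0 8; Tip 1];
    Pattern 9637 [:: Corner 1; Corner 2; Arc 49 9; Corner 3; Corner 0] false [:: Tip 1];
    Pattern 73 [:: Corner 1; Corner 2; Arc 48 10; Corner 3] false [:: Tip 0; Tip 1]]))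
  (Leaf 1008639 [:: Pattern 2459 [:: Corner 1; Corner 2; Tip 2; Tip 0] false [:: Corner 0; Arc 10 27];
    Pattern 7194 [:: Arc 36 22; Tip 0] false [:: Tip 1; Arc 19 17];
    Pattern 347 [:: Corner 1; Corner 2; Arc 47 11; Tip 0] false [:: Tip 1; Arc 20 7]]))
  (Cut 2 (124074)
  (Cut 0 (44062)
  (Cut 0 (-52406)
  (Leaf 1008635 [:: Pattern 10000 [:: Corner 1; Corner 2; Arc 43 18; Corner 3; Corner 0] false [:: Arc 12 18]])
  (Cut 2 (-24825)
  (Leaf 1008635 [:: Pattern 3996 [:: Tip 2; Arc 54 7; Corner 3; Corner 0] false [:: Arc 10 18; Corner 1];
    Pattern 2286 [:: Corner 1; Corner 2; Arc 47 14; Corner 3; Corner 0] false [:: Arc 10 18];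
    Pattern 155 [:: Corner 1; Corner 2; Arc 47 14; Corner 3; Corner 0] false [:: Arc 9 19];
    Pattern 3563 [:: Corner 1; Corner 2; Arc 46 17; Corner 3; Corner 0] false [:: Arc 11 6; Tip 1]])
  (Cut 3 (36679)
  (Cut 2 (19845)
  (Leaf 1008635 [:: Pattern 1741 [:: Corner 1; Corner 2; Tip 2; Arc 54 6; Corner 3; Corner 0] false [:: Arc 11 6; Tip 1; Arc 28 4];
    Pattern 7475 [:: Corner 1; Corner 2; Tip 2; Arc 54 6; Corner 3; Corner 0] false [:: Arc 11 6; Tip 1];
    Pattern 785 [:: Corner 1; Corner 2; Tip 2; Arc 54 5; Corner 3; Corner 0] false [:: Arc 10 8; Tip 1; Arc 28 5]])
  (Cut 3 (-25087)
  (Leaf 1008635 [:: Pattern 4330 [:: Corner 1; Corner 2; Arc 44 1; Tip 2; Arc 58 2] true [:: Arc 10 22];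
    Pattern 1468 [:: Corner 1; Corner 2; Arc 44 1; Tip 2; Arc 57 3; Corner 3; Corner 0] false [:: Arc 11 21];
    Pattern 4202 [:: Corner 1; Corner 2; Tip 2; Arc 57 3; Tip 0] false [:: Corner 0; Arc 10 20]])
  (Cut 3 (18149)
  (Turn 99144 (-13052)
  (Cut 0 (-1760)
  (Cut 1 (-23125)
  (Leaf 1002154 [:: Pattern 1639 [:: Corner 1; Corner 2; Arc 41 4; Tip 2; Arc 55 6; Tip 0] false [:: Corner 0; Tip 1; Arc 24 4];
    Pattern 2693 [:: Corner 1; Corner 2; Arc 43 20; Corner 3; Corner 0] false [:: Arc 12 1; Tip 1; Arc 26 1];
    Pattern 2904 [:: Corner 1; Corner 2; Tip 2; Arc 55 7; Tip 0] false [:: Corner 0; Arc 12 1; Tip 1; Arc 25 2];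
    Pattern 2764 [:: Corner 1; Corner 2; Arc 41 1; Tip 2; Arc 55 7; Corner 3; Corner 0] false [:: Arc 12 1; Tip 1; Arc 27 1]])
  (Cut 1 (41188)
  (Cut 2 (92805)
  (Cut 1 (-3831)
  (Leaf 1002154 [:: Pattern 1669 [:: Corner 1; Corner 2; Arc 44 1; Tip 2; Arc 53 8; Tip 0] false [:: Corner 0; Arc 12 2; Tip 1; Arc 24 4];
    Pattern 2793 [:: Corner 1; Corner 2; Arc 44 1; Tip 2; Arc 53 9; Corner 3; Corner 0] false [:: Arc 12 2; Tip 1; Arc 24 4];
    Pattern 3674 [:: Corner 1; Corner 2; Arc 44 18; Corner 3; Corner 0] false [:: Arc 12 2; Tip 1; Arc 24 4];
    Pattern 1864 [:: Corner 1; Corner 2; Tip 2; Arc 53 8; Tip 0] false [:: Corner 0; Arc 12 2; Tip 1; Arc 24 4]])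
  (Cut 2 (41733)
  (Leaf 1002154 [:: Pattern 5919 [:: Corner 1; Corner 2; Tip 2; Arc 53 8; Corner 3; Corner 0] false [:: Arc 10 5; Tip 1; Arc 26 3];
    Pattern 4081 [:: Corner 1; Corner 2; Arc 44 1; Tip 2; Arc 53 8; Corner 3; Corner 0] false [:: Arc 10 5; Tip 1; Arc 26 3]])
  (Cut 0 (-37212)
  (Leaf 1002154 [:: Pattern 7608 [:: Corner 1; Corner 2; Arc 46 1; Tip 2; Arc 54 6; Corner 3; Corner 0] false [:: Arc 11 4; Tip 1; Arc 23 7];
    Pattern 311 [:: Corner 1; Corner 2; Arc 45 2; Tip 2; Arc 53 7; Tip 0] false [:: Corner 0; Arc 11 4; Tip 1; Arc 22 8];
    Pattern 2008 [:: Corner 1; Corner 2; Arc 44 17; Tip 0] false [:: Corner 0; Arc 12 1; Tip 1; Arc 23 6];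
    Pattern 73 [:: Corner 1; Corner 2; Arc 45 15; Corner 3; Corner 0] false [:: Arc 11 2; Tip 1; Arc 23 8]])
  (Cut 0 (-12396)
  (Cut 2 (60885)
  (Cut 1 (7424)
  (Leaf 1002154 [:: Pattern 1404 [:: Corner 1; Corner 2; Arc 45 2; Tip 2; Arc 52 9; Tip 0] false [:: Corner 0; Arc 11 3; Tip 1; Arc 24 5];
    Pattern 6561 [:: Corner 1; Corner 2; Arc 45 2; Tip 2; Arc 52 9; Corner 3; Corner 0] false [:: Arc 11 3; Tip 1; Arc 24 5];
    Pattern 826 [:: Corner 1; Corner 2; Arc 46 1; Tip 2; Arc 51 10; Tip 0] false [:: Corner 0; Arc 11 3; Tip 1; Arc 24 4];
    Pattern 1209 [:: Corner 1; Corner 2; Tip 2; Arc 52 9; Tip 0] false [:: Corner 0; Arc 11 3; Tip 1; Arc 24 4]])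
  (Leaf 1002154 [:: Pattern 973 [:: Corner 1; Corner 2; Arc 45 2; Tip 2; Arc 53 8; Tip 0] false [:: Corner 0; Arc 11 3; Tip 1; Arc 23 6];
    Pattern 1210 [:: Corner 1; Corner 2; Arc 45 2; Tip 2; Arc 53 8; Corner 3; Corner 0] false [:: Arc 11 3; Tip 1; Arc 23 6];
    Pattern 1543 [:: Corner 1; Corner 2; Tip 2; Arc 53 8; Tip 0] false [:: Corner 0; Arc 10 5; Tip 1; Arc 23 5];
    Pattern 6274 [:: Corner 1; Corner 2; Arc 46 1; Tip 2; Arc 52 9; Corner 3; Corner 0] false [:: Arc 10 4; Tip 1; Arc 24 5]]))
  (Leaf 1002154 [:: Pattern 1668 [:: Corner 1; Corner 2; Arc 46 2; Tip 2; Arc 53 8; Tip 0] false [:: Corner 0; Arc 10 4; Tip 1; Arc 23 6];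
    Pattern 4563 [:: Corner 1; Corner 2; Arc 46 2; Tip 2; Arc 53 8; Corner 3; Corner 0] false [:: Arc 10 4; Tip 1; Arc 23 6];
    Pattern 2731 [:: Corner 1; Corner 2; Arc 46 2; Tip 2; Arc 53 8; Corner 3; Corner 0] false [:: Arc 10 4; Tip 1; Arc 22 7];
    Pattern 210 [:: Corner 1; Corner 2; Arc 46 2; Tip 2; Arc 53 8; Corner 3; Corner 0] false [:: Arc 11 3; Tip 1; Arc 23 6];
    Pattern 829 [:: Corner 1; Corner 2; Tip 2; Arc 53 8; Tip 0] false [:: Corner 0; Arc 10 4; Tip 1; Arc 23 6]]))
  (Leaf 1002154 [:: Pattern 3168 [:: Corner 1; Corner 2; Arc 46 1; Tip 2; Arc 53 8; Corner 3; Corner 0] false [:: Arc 10 4; Tip 1; Arc 24 5];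
    Pattern 2232 [:: Corner 1; Corner 2; Arc 47 14] true [:: Arc 9 5; Tip 1; Arc 24 5];
    Pattern 1296 [:: Corner 1; Corner 2; Arc 47 14; Corner 3; Corner 0] false [:: Arc 10 3; Tip 1; Arc 25 3];
    Pattern 3304 [:: Corner 1; Corner 2; Tip 2; Arc 53 8; Tip 0] false [:: Corner 0; Arc 10 3; Tip 1; Arc 23 5]])))))
  (Leaf 1002154 [:: Pattern 3789 [:: Corner 1; Corner 2; Arc 45 5; Tip 2; Arc 55 5; Corner 3; Corner 0] false [:: Arc 11 2; Tip 1; Arc 20 12];
    Pattern 2603 [:: Corner 1; Corner 2; Arc 47 13] true [:: Arc 10 1; Tip 1; Arc 22 9];
    Pattern 3608 [:: Corner 1; Corner 2; Arc 48 3; Tip 2; Arc 55 5; Tip 0] false [:: Corner 0; Arc 9 3; Tip 1; Arc 20 10]]))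
  (Leaf 1002154 [:: Pattern 3310 [:: Corner 1; Corner 2; Tip 2; Arc 55 5; Corner 3; Corner 0] false [:: Arc 8 21];
    Pattern 479 [:: Corner 1; Corner 2; Tip 2; Arc 55 6; Tip 0] false [:: Corner 0; Arc 8 21];
    Pattern 6211 [:: Corner 1; Corner 2; Arc 49 10] true [:: Arc 9 4; Tip 1; Arc 23 8]])))
  (Leaf 1002154 [:: Pattern 4554 [:: Corner 1; Corner 2; Tip 2; Arc 55 7; Tip 0] false [:: Corner 0; Arc 9 4; Tip 1; Arc 25 4];
    Pattern 3741 [:: Corner 1; Corner 2; Arc 47 14; Corner 3; Corner 0] false [:: Arc 9 4; Tip 1; Arc 26 2];
    Pattern 177 [:: Corner 1; Corner 2; Arc 46 17] true [:: Arc 10 2; Tip 1; Arc 26 1];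
    Pattern 1527 [:: Corner 1; Corner 2; Arc 49 11] true [:: Arc 8 5; Tip 1; Arc 25 4]]))
  (Cut 0 (-4172)
  (Cut 1 (29375)
  (Cut 1 (-16562)
  (Leaf 1002150 [:: Pattern 4945 [:: Corner 1; Corner 2; Arc 44 3; Tip 2; Arc 57 5] true [:: Arc 12 3; Tip 1; Arc 24 3];
    Pattern 4149 [:: Corner 1; Corner 2; Arc 44 3; Tip 2; Arc 57 6] true [:: Arc 12 3; Tip 1; Arc 24 3];
    Pattern 209 [:: Corner 1; Corner 2; Arc 44 18; Tip 0] false [:: Corner 0; Arc 12 3; Tip 1; Arc 24 3];
    Pattern 697 [:: Corner 1; Corner 2; Arc 44 19] true [:: Arc 12 3; Tip 1; Arc 24 3]])
  (Cut 2 (92805)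
  (Cut 2 (47205)
  (Leaf 1002150 [:: Pattern 1158 [:: Corner 1; Corner 2; Arc 45 2; Tip 2; Arc 54 9; Corner 3; Corner 0] false [:: Arc 11 5; Tip 1; Arc 26 1];
    Pattern 1432 [:: Corner 1; Corner 2; Arc 45 1; Tip 2; Arc 55 7; Corner 3; Corner 0] false [:: Arc 11 7; Tip 1; Arc 25 3];
    Pattern 1049 [:: Corner 1; Corner 2; Tip 2; Arc 55 7; Tip 0] false [:: Corner 0; Arc 11 6; Tip 1; Arc 25 2];
    Pattern 6360 [:: Corner 1; Corner 2; Arc 46 1; Tip 2; Arc 54 8; Corner 3; Corner 0] false [:: Arc 10 6; Tip 1; Arc 26 2]])
  (Leaf 1002150 [:: Pattern 1383 [:: Corner 1; Corner 2; Arc 45 2; Tip 2; Arc 55 7] true [:: Arc 11 6; Tip 1; Arc 24 4];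
    Pattern 1667 [:: Corner 1; Corner 2; Arc 45 2; Tip 2; Arc 56 6] true [:: Arc 11 6; Tip 1; Arc 22 6];
    Pattern 242 [:: Corner 1; Corner 2; Arc 45 2; Tip 2; Arc 56 5; Corner 3; Corner 0] false [:: Arc 11 6; Tip 1; Arc 23 5];
    Pattern 6573 [:: Corner 1; Corner 2; Arc 45 4; Tip 2; Arc 55 7] true [:: Arc 11 5; Tip 1; Arc 23 5];
    Pattern 135 [:: Corner 1; Corner 2; Arc 44 5; Tip 2; Arc 55 7; Corner 3; Corner 0] false [:: Arc 12 4; Tip 1; Arc 23 5]]))
  (Leaf 1002150 [:: Pattern 430 [:: Corner 1; Corner 2; Arc 43 8; Tip 2; Arc 57 4] true [:: Arc 12 3; Tip 1; Arc 21 9];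
    Pattern 5979 [:: Corner 1; Corner 2; Arc 46 4; Tip 2; Arc 57 4] true [:: Arc 11 4; Tip 1; Arc 20 9];
    Pattern 1046 [:: Corner 1; Corner 2; Arc 44 6; Tip 2; Arc 57 4; Tip 0] false [:: Corner 0; Arc 12 3; Tip 1; Arc 20 8];
    Pattern 2545 [:: Corner 1; Corner 2; Arc 45 16] true [:: Arc 11 2; Tip 1; Arc 23 6]])))
  (Leaf 1002150 [:: Pattern 700 [:: Corner 1; Corner 2; Arc 45 2; Tip 2; Arc 57 3; Corner 3; Corner 0] false [:: Arc 11 4; Tip 1; Arc 25 7];
    Pattern 5667 [:: Corner 1; Corner 2; Arc 46 1; Tip 2; Arc 57 4] true [:: Arc 9 6; Tip 1; Arc 24 4];
    Pattern 1495 [:: Corner 1; Corner 2; Arc 46 1; Tip 2; Arc 58 2] true [:: Arc 10 21];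
    Pattern 2138 [:: Corner 1; Corner 2; Arc 48 11] true [:: Arc 9 6; Tip 1; Arc 24 7]]))
  (Leaf 1002150 [:: Pattern 8831 [:: Corner 1; Corner 2; Arc 46 1; Tip 2; Arc 57 6] true [:: Arc 10 5; Tip 1; Arc 24 3];
    Pattern 494 [:: Corner 1; Corner 2; Arc 46 17] true [:: Arc 11 4; Tip 1; Arc 24 3];
    Pattern 181 [:: Corner 1; Corner 2; Arc 46 16; Tip 0] false [:: Arc 10 5; Tip 1; Arc 24 3];
    Pattern 494 [:: Corner 1; Corner 2; Arc 46 1; Tip 2; Arc 57 5] true [:: Arc 10 5; Tip 1; Arc 24 3]])))
  (Leaf 1008635 [:: Pattern 1708 [:: Corner 1; Corner 2; Arc 43 18; Corner 3; Corner 0] false [:: Arc 12 1; Tip 1; Arc 29 1];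
    Pattern 7467 [:: Corner 1; Corner 2; Arc 46 16] true [:: Arc 11 1; Tip 1; Arc 26 2];
    Pattern 634 [:: Corner 1; Corner 2; Tip 2; Arc 57 7] true [:: Arc 9 4; Tip 1];
    Pattern 191 [:: Corner 1; Corner 2; Arc 39 24; Corner 3; Corner 0] false [:: Tip 1]]))))
  (Leaf 1008635 [:: Pattern 683 [:: Corner 1; Corner 2; Arc 49 9; Corner 3; Corner 0] false [:: Arc 8 5; Tip 1];
    Pattern 4219 [:: Corner 1; Corner 2; Arc 49 9; Corner 3; Corner 0] false [:: Arc 8 5; Tip 1; Arc 32 1];
    Pattern 3287 [:: Corner 1; Corner 2; Arc 39 24; Corner 3; Corner 0] false [:: Tip 1];
    Pattern 1811 [:: Corner 1; Corner 2; Arc 46 16; Corner 3] false [:: Tip 0; Tip 1]]))))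
  (Leaf 1008635 [:: Pattern 530 [:: Corner 1; Corner 2; Arc 46 19] true [:: Arc 10 14];
    Pattern 65 [:: Tip 2; Tip 0] false [:: Corner 0; Arc 10 14; Corner 1];
    Pattern 1306 [:: Tip 2; Arc 57 8] true [:: Arc 8 5; Tip 1; Corner 1];
    Pattern 8098 [:: Corner 1; Corner 2; Arc 48 17] true [:: Arc 8 18]]))
  (Leaf 1008635 [:: Pattern 310 [:: Corner 1; Corner 2; Arc 43 8; Tip 2; Tip 0] false [:: Corner 0; Arc 12 18];
    Pattern 7683 [:: Corner 1; Corner 2; Arc 43 17] true [:: Arc 12 18];
    Pattern 623 [:: Arc 36 24; Tip 0] false [:: Tip 1; Arc 20 10; Corner 1];
    Pattern 1383 [:: Corner 1; Corner 2; Arc 47 7; Tip 2; Tip 0] false [:: Tip 1; Arc 20 7]]))))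
  (Leaf 1035284 [:: Pattern 10000 [:: Corner 1; Corner 2; Arc 51 11; Corner 3; Corner 0] false [:: Tip 1]]))
  (Cut 3 (87100)
  (Cut 3 (-80970)
  (Leaf 1035284 [:: Pattern 5545 [:: Tip 2] false [:: Corner 3; Arc 14 16; Corner 2];
    Pattern 3917 [:: Tip 2] false [:: Corner 3; Arc 8 14; Corner 1];
    Pattern 538 [:: Tip 2; Tip 0] false [:: Corner 0; Arc 10 18; Corner 2]])
  (Turn 96592 (25881)
  (Cut 2 (124074)
  (Cut 0 (44062)
  (Cut 0 (-52406)
  (Leaf 1008635 [:: Pattern 10000 [:: Corner 1; Corner 2; Arc 43 18; Corner 3; Corner 0] false [:: Arc 12 18]])
  (Cut 2 (-74459)
  (Leaf 1008635 [:: Pattern 3397 [:: Tip 2; Arc 57 5; Corner 3; Corner 0] false [:: Arc 5 22; Corner 1];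
    Pattern 518 [:: Tip 2; Arc 56 13; Corner 3; Corner 0] false [:: Arc 12 10; Corner 1];
    Pattern 4109 [:: Corner 1; Corner 2; Arc 45 24; Corner 3; Corner 0] false [:: Arc 12 3; Tip 1];
    Pattern 1976 [:: Tip 1; Tip 2; Arc 55 7; Corner 3; Corner 0] false [:: Arc 10 9]])
  (Cut 2 (-14899)
  (Leaf 1008635 [:: Pattern 10000 [:: Corner 1; Corner 2; Tip 2; Arc 55 7; Corner 3; Corner 0] false [:: Arc 10 9; Tip 1]])
  (Cut 3 (36679)
  (Cut 3 (-22146)
  (Leaf 1008635 [:: Pattern 9166 [:: Corner 1; Corner 2; Arc 45 1; Tip 2; Arc 60 3] true [:: Arc 11 16];
    Pattern 128 [:: Corner 1; Corner 2; Tip 2; Arc 60 3; Corner 3; Corner 0] false [:: Arc 9 7; Tip 1];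
    Pattern 706 [:: Corner 1; Corner 2; Tip 2; Corner 3; Corner 0] false [:: Arc 9 7; Tip 1; Arc 33 1]])
  (Turn 99144 (13052)
  (Cut 0 (15122)
  (Cut 2 (82382)
  (Cut 2 (33741)
  (Leaf 1002150 [:: Pattern 3377 [:: Corner 1; Corner 2; Arc 41 5; Tip 2; Arc 56 6; Corner 3; Corner 0] false [:: Arc 13 5; Tip 1; Arc 30 1];
    Pattern 265 [:: Corner 1; Corner 2; Arc 39 7; Tip 2; Arc 56 7; Corner 3; Corner 0] false [:: Arc 15 10];
    Pattern 6358 [:: Corner 1; Corner 2; Tip 2; Arc 55 7; Corner 3; Corner 0] false [:: Arc 11 7; Tip 1]])
  (Leaf 1002150 [:: Pattern 3998 [:: Corner 1; Corner 2; Arc 45 5; Tip 2; Arc 57 5] true [:: Arc 11 6; Tip 1; Arc 25 3];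
    Pattern 316 [:: Corner 1; Corner 2; Arc 44 6; Tip 2; Arc 57 5; Corner 3; Corner 0] false [:: Arc 11 6; Tip 1; Arc 25 4];
    Pattern 3397 [:: Corner 1; Corner 2; Arc 45 5; Tip 2; Arc 58 4] true [:: Arc 11 6; Tip 1; Arc 25 3];
    Pattern 2289 [:: Corner 1; Corner 2; Arc 45 4; Tip 2; Arc 57 5] true [:: Arc 11 7; Tip 1; Arc 25 3];
    Pattern 1 [:: Corner 1; Corner 2; Arc 44 6; Tip 2; Arc 58 4] true [:: Arc 12 6; Tip 1; Arc 25 3]]))
  (Leaf 1002150 [:: Pattern 9333 [:: Corner 1; Corner 2; Arc 45 6; Tip 2; Arc 58 4] true [:: Arc 11 5; Tip 1; Arc 23 5];
    Pattern 58 [:: Corner 1; Corner 2; Arc 44 6; Tip 2; Arc 58 4] true [:: Arc 11 18];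
    Pattern 437 [:: Corner 1; Corner 2; Arc 44 8; Tip 2; Arc 58 4] true [:: Arc 12 4; Tip 1; Arc 24 5];
    Pattern 172 [:: Corner 1; Corner 2; Arc 45 6; Tip 2; Arc 58 3] true [:: Arc 11 5; Tip 1; Arc 23 7]]))
  (Leaf 1002150 [:: Pattern 471 [:: Corner 1; Corner 2; Arc 44 2; Tip 2; Arc 58 5; Tip 0] false [:: Corner 0; Arc 13 3; Tip 1];
    Pattern 898 [:: Corner 1; Corner 2; Arc 44 2; Tip 2; Arc 58 5; Tip 0] false [:: Arc 11 12];
    Pattern 171 [:: Corner 1; Corner 2; Arc 47 17; Tip 0] false [:: Arc 11 5; Tip 1];
    Pattern 8460 [:: Corner 1; Corner 2; Tip 2; Arc 58 6; Tip 0] false [:: Arc 11 5; Tip 1]]))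
  (Cut 0 (-1760)
  (Cut 1 (29375)
  (Cut 2 (82382)
  (Cut 2 (33741)
  (Leaf 1002154 [:: Pattern 6089 [:: Corner 1; Corner 2; Arc 44 2; Tip 2; Arc 57 6; Corner 3; Corner 0] false [:: Arc 12 8; Tip 1];
    Pattern 3911 [:: Corner 1; Corner 2; Tip 2; Arc 57 6; Corner 3; Corner 0] false [:: Arc 12 8; Tip 1]])
  (Cut 1 (-34937)
  (Leaf 1002154 [:: Pattern 3337 [:: Corner 1; Corner 2; Arc 43 7; Tip 2; Arc 59 5] true [:: Arc 13 12];
    Pattern 4719 [:: Corner 1; Corner 2; Arc 43 8; Tip 2; Arc 59 4; Corner 3; Corner 0] false [:: Arc 13 7; Tip 1; Arc 27 1];
    Pattern 1944 [:: Corner 1; Corner 2; Arc 44 8; Tip 2; Arc 59 5; Corner 3] false [:: Tip 0; Arc 13 6; Tip 1]])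
  (Cut 1 (10081)
  (Cut 2 (48333)
  (Leaf 1002154 [:: Pattern 1984 [:: Corner 1; Corner 2; Arc 45 3; Tip 2; Arc 59 4; Corner 3; Corner 0] false [:: Arc 12 11; Tip 1];
    Pattern 5394 [:: Corner 1; Corner 2; Arc 45 3; Tip 2; Arc 59 4; Corner 3; Corner 0] false [:: Arc 12 11; Tip 1; Arc 27 1];
    Pattern 320 [:: Corner 1; Corner 2; Arc 44 5; Tip 2; Arc 58 4; Corner 3; Corner 0] false [:: Arc 12 8; Tip 1];
    Pattern 2302 [:: Corner 1; Corner 2; Arc 44 5; Tip 2; Arc 58 4; Corner 3; Corner 0] false [:: Tip 0; Arc 12 8; Tip 1]])
  (Cut 0 (-37212)
  (Leaf 1002154 [:: Pattern 1815 [:: Corner 1; Corner 2; Arc 43 9; Tip 2; Arc 58 5; Corner 3; Corner 0] false [:: Tip 0; Arc 13 6; Tip 1; Arc 26 1];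
    Pattern 256 [:: Corner 1; Corner 2; Arc 43 9; Tip 2; Arc 58 5; Corner 3; Corner 0] false [:: Tip 0; Arc 13 6; Tip 1];
    Pattern 1400 [:: Corner 1; Corner 2; Arc 42 11; Tip 2; Arc 59 4] true [:: Arc 13 6; Tip 1; Arc 25 1];
    Pattern 6529 [:: Corner 1; Corner 2; Arc 43 7; Tip 2; Arc 59 3; Corner 3; Corner 0] false [:: Arc 12 9; Tip 1; Arc 25 4]])
  (Cut 0 (-12396)
  (Cut 3 (5796)
  (Leaf 1002154 [:: Pattern 1644 [:: Corner 1; Corner 2; Arc 44 6; Tip 2; Arc 59 4] true [:: Arc 12 9; Tip 1; Arc 25 2];
    Pattern 5751 [:: Corner 1; Corner 2; Arc 44 6; Tip 2; Arc 59 4; Corner 3; Corner 0] false [:: Arc 12 9; Tip 1; Arc 25 2];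
    Pattern 1840 [:: Corner 1; Corner 2; Arc 44 6; Tip 2; Arc 59 4; Corner 3; Corner 0] false [:: Tip 0; Arc 12 9; Tip 1; Arc 25 2];
    Pattern 764 [:: Corner 1; Corner 2; Arc 44 6; Tip 2; Arc 59 4; Corner 3; Corner 0] false [:: Tip 0; Arc 12 9; Tip 1]])
  (Cut 3 (13517)
  (Cut 2 (72167)
  (Turn 98078 (19509)
  (Leaf 1000542 [:: Pattern 2248 [:: Corner 1; Corner 2; Arc 44 6; Tip 2; Arc 58 5; Corner 3; Corner 0] false [:: Tip 0; Arc 12 8; Tip 1; Arc 25 2];
    Pattern 5490 [:: Corner 1; Corner 2; Arc 44 6; Tip 2; Arc 58 5; Corner 3; Corner 0] false [:: Arc 12 8; Tip 1; Arc 25 2];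
    Pattern 1835 [:: Corner 1; Corner 2; Arc 44 6; Tip 2; Arc 59 4] true [:: Arc 12 8; Tip 1; Arc 24 2];
    Pattern 427 [:: Corner 1; Corner 2; Arc 44 6; Tip 2; Arc 58 4; Corner 3; Corner 0] false [:: Tip 0; Arc 12 7; Tip 1]])
  (Leaf 1000543 [:: Pattern 5500 [:: Corner 1; Corner 2; Arc 42 9; Tip 2; Arc 61 2; Corner 3; Corner 0] false [:: Arc 13 13];
    Pattern 4500 [:: Corner 1; Corner 2; Arc 44 6; Tip 2; Arc 59 3; Corner 3; Corner 0] false [:: Tip 0; Arc 13 8; Tip 1]]))
  (Leaf 1002154 [:: Pattern 3175 [:: Corner 1; Corner 2; Arc 43 8; Tip 2; Arc 59 4; Corner 3] false [:: Tip 0; Arc 13 7; Tip 1; Arc 24 3];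
    Pattern 2731 [:: Corner 1; Corner 2; Arc 43 8; Tip 2; Arc 59 4] true [:: Arc 13 7; Tip 1; Arc 24 3];
    Pattern 1779 [:: Corner 1; Corner 2; Arc 43 8; Tip 2; Arc 59 4; Corner 3; Corner 0] false [:: Arc 13 7; Tip 1; Arc 25 2];
    Pattern 2315 [:: Corner 1; Corner 2; Arc 43 8; Tip 2; Arc 60 3; Corner 3; Corner 0] false [:: Arc 13 8; Tip 1; Arc 24 3]]))
  (Leaf 1002154 [:: Pattern 4775 [:: Corner 1; Corner 2; Arc 43 9; Tip 2; Arc 59 4; Corner 3; Corner 0] false [:: Arc 13 6; Tip 1; Arc 25 1];
    Pattern 1337 [:: Corner 1; Corner 2; Arc 43 9; Tip 2; Arc 59 4; Corner 3; Corner 0] false [:: Tip 0; Arc 13 6; Tip 1; Arc 25 2];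
    Pattern 3015 [:: Corner 1; Corner 2; Arc 43 9; Tip 2; Arc 59 4; Corner 3; Corner 0] false [:: Tip 0; Arc 13 6; Tip 1];
    Pattern 873 [:: Corner 1; Corner 2; Arc 42 10; Tip 2; Arc 59 4; Corner 3; Corner 0] false [:: Arc 13 6; Tip 1; Arc 25 2]])))
  (Leaf 1002154 [:: Pattern 4694 [:: Corner 1; Corner 2; Arc 45 3; Tip 2; Arc 59 4; Corner 3; Corner 0] false [:: Arc 12 9; Tip 1; Arc 25 1];
    Pattern 1814 [:: Corner 1; Corner 2; Arc 44 6; Tip 2; Arc 60 4] true [:: Arc 13 12];
    Pattern 446 [:: Corner 1; Corner 2; Arc 45 5; Tip 2; Arc 59 4; Corner 3] false [:: Tip 0; Arc 12 9; Tip 1; Arc 25 1];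
    Pattern 3046 [:: Corner 1; Corner 2; Arc 45 5; Tip 2; Arc 59 4; Corner 3] false [:: Tip 0; Arc 12 9; Tip 1]]))))
  (Leaf 1002154 [:: Pattern 3906 [:: Corner 1; Corner 2; Arc 46 1; Tip 2; Arc 60 1; Corner 3; Corner 0] false [:: Arc 11 17];
    Pattern 1594 [:: Corner 1; Corner 2; Arc 44 3; Tip 2; Arc 59 2; Corner 3; Corner 0] false [:: Arc 12 9; Tip 1; Arc 29 2];
    Pattern 2601 [:: Corner 1; Corner 2; Arc 46 4; Tip 2; Arc 59 2; Corner 3; Corner 0] false [:: Tip 0; Arc 12 8; Tip 1; Arc 27 2];
    Pattern 1898 [:: Corner 1; Corner 2; Arc 46 4; Tip 2; Arc 59 2; Corner 3; Corner 0] false [:: Tip 0; Arc 12 8; Tip 1]]))))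
  (Leaf 1002154 [:: Pattern 7653 [:: Corner 1; Corner 2; Arc 43 9; Tip 2; Arc 60 2] true [:: Arc 13 5; Tip 1; Arc 23 4];
    Pattern 1835 [:: Corner 1; Corner 2; Arc 43 9; Tip 2; Arc 60 2; Corner 3] false [:: Tip 0; Arc 13 5; Tip 1; Arc 23 4];
    Pattern 454 [:: Corner 1; Corner 2; Arc 43 9; Tip 2; Arc 60 3; Corner 3] false [:: Tip 0; Arc 13 13];
    Pattern 59 [:: Corner 1; Corner 2; Arc 44 8; Tip 2; Corner 3] false [:: Tip 0; Arc 13 14]]))
  (Leaf 1002154 [:: Pattern 3700 [:: Corner 1; Corner 2; Arc 45 3; Tip 2; Arc 60 1; Corner 3; Corner 0] false [:: Tip 0; Arc 11 7; Tip 1];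
    Pattern 2700 [:: Corner 1; Corner 2; Tip 2; Arc 60 1; Corner 3; Corner 0] false [:: Arc 11 7; Tip 1];
    Pattern 3601 [:: Corner 1; Corner 2; Arc 47 1; Tip 2; Corner 3; Corner 0] false [:: Tip 0; Arc 12 19]]))
  (Leaf 1002154 [:: Pattern 4907 [:: Corner 1; Corner 2; Arc 45 3; Tip 2; Arc 60 4] true [:: Arc 12 13];
    Pattern 3969 [:: Corner 1; Corner 2; Arc 44 4; Tip 2; Arc 60 5; Corner 3; Corner 0] false [:: Tip 0; Arc 11 7; Tip 1];
    Pattern 652 [:: Corner 1; Corner 2; Arc 46 1; Tip 2; Arc 60 3; Corner 3; Corner 0] false [:: Arc 11 15];
    Pattern 472 [:: Corner 1; Corner 2; Arc 47 1; Tip 2; Arc 60 4; Corner 3] false [:: Tip 0; Arc 12 6; Tip 1]]))))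
  (Leaf 1008635 [:: Pattern 5229 [:: Corner 1; Corner 2; Arc 47 12; Corner 3; Corner 0] false [:: Tip 0; Arc 10 6; Tip 1];
    Pattern 3764 [:: Corner 1; Corner 2; Arc 39 24; Corner 3; Corner 0] false [:: Tip 1];
    Pattern 1008 [:: Corner 1; Corner 2; Arc 46 16; Corner 3] false [:: Tip 0; Tip 1]])))))
  (Leaf 1008635 [:: Pattern 4082 [:: Corner 1; Corner 2; Arc 48 17] true [:: Arc 8 18];
    Pattern 3783 [:: Corner 1; Corner 2; Arc 47 18] true [:: Arc 9 15];
    Pattern 446 [:: Corner 1; Corner 2; Arc 47 26] false [:: Tip 0; Arc 17 7];
    Pattern 1689 [:: Corner 1; Corner 2; Tip 2; Arc 60 4] true [:: Arc 8 8; Tip 1]]))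
  (Leaf 1008635 [:: Pattern 6545 [:: Corner 1; Corner 2; Arc 43 17] true [:: Arc 12 18];
    Pattern 1779 [:: Corner 1; Corner 2; Arc 43 19] true [:: Arc 14 14];
    Pattern 160 [:: Corner 1; Corner 2; Arc 43 7; Tip 2; Tip 0] false [:: Arc 12 18];
    Pattern 1516 [:: Corner 1; Corner 2; Arc 47 7; Tip 2; Tip 0] false [:: Tip 1; Arc 19 8]]))
  (Cut 2 (124074)
  (Cut 3 (36679)
  (Cut 2 (-74459)
  (Leaf 1008639 [:: Pattern 1959 [:: Corner 1; Corner 2; Arc 46 19; Corner 3; Corner 0] false [:: Arc 10 11; Tip 1];
    Pattern 1748 [:: Tip 1; Tip 2; Arc 57 8; Corner 3; Corner 0] false [:: Arc 10 11];
    Pattern 2282 [:: Corner 1; Corner 2; Arc 48 16; Corner 3; Corner 0] false [:: Tip 0; Arc 18 3; Tip 1];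
    Pattern 4011 [:: Tip 2; Arc 56 9; Corner 3; Corner 0] false [:: Arc 13 10; Corner 1]])
  (Cut 3 (-25087)
  (Leaf 1008639 [:: Pattern 4854 [:: Corner 1; Corner 2; Arc 43 22; Corner 3; Corner 0] false [:: Arc 13 11];
    Pattern 4747 [:: Corner 1; Corner 2; Tip 2; Corner 3; Corner 0] false [:: Arc 13 11];
    Pattern 399 [:: Corner 1; Corner 2; Arc 43 1; Tip 2; Arc 65 8] false [:: Corner 0; Arc 13 10]])
  (Cut 1 (29375)
  (Cut 2 (-14899)
  (Leaf 1008639 [:: Pattern 1930 [:: Corner 1; Corner 2; Arc 43 1; Tip 2; Arc 58 6; Corner 3; Corner 0] false [:: Arc 14 8; Tip 1];
    Pattern 1433 [:: Corner 1; Corner 2; Tip 2; Arc 58 6; Corner 3; Corner 0] false [:: Arc 14 8; Tip 1];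
    Pattern 3648 [:: Corner 1; Corner 2; Arc 43 1; Tip 2; Arc 57 8; Corner 3; Corner 0] false [:: Tip 0; Arc 12 9; Tip 1];
    Pattern 2989 [:: Corner 1; Corner 2; Arc 43 1; Tip 2; Arc 58 6; Corner 3; Corner 0] false [:: Arc 15 9]])
  (Cut 2 (51113)
  (Leaf 1008639 [:: Pattern 845 [:: Corner 1; Corner 2; Arc 43 7; Tip 2; Arc 61 2; Corner 3; Corner 0] false [:: Arc 14 12];
    Pattern 4568 [:: Corner 1; Corner 2; Arc 43 6; Tip 2; Arc 60 4; Corner 3; Corner 0] false [:: Tip 0; Arc 13 10; Tip 1];
    Pattern 4151 [:: Corner 1; Corner 2; Arc 44 4; Tip 2; Arc 61 3; Corner 3; Corner 0] false [:: Arc 13 12];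
    Pattern 432 [:: Corner 1; Corner 2; Arc 43 7; Tip 2; Arc 62 2; Corner 3; Corner 0] false [:: Tip 0; Arc 13 12; Tip 1];
    Pattern 5 [:: Corner 1; Corner 2; Arc 43 5; Tip 2; Arc 64 1; Corner 3; Corner 0] false [:: Arc 14 10]])
  (Cut 0 (44062)
  (Cut 0 (2719)
  (Cut 2 (96714)
  (Leaf 1008639 [:: Pattern 5079 [:: Corner 1; Corner 2; Arc 43 7; Tip 2; Arc 62 1; Corner 3; Corner 0] false [:: Arc 14 11];
    Pattern 4200 [:: Corner 1; Corner 2; Arc 43 8; Tip 2; Arc 62 2; Corner 3; Corner 0] false [:: Tip 0; Arc 14 7; Tip 1];
    Pattern 720 [:: Corner 1; Corner 2; Arc 43 8; Tip 2; Corner 3; Corner 0] false [:: Tip 0; Arc 14 14]])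
  (Cut 1 (-56758)
  (Cut 0 (-81691)
  (Leaf 1008639 [:: Pattern 10000 [:: Arc 36 16; Tip 2; Corner 3; Corner 0] false [:: Tip 0; Arc 15 14; Corner 1; Arc 33 3]])
  (Leaf 1008639 [:: Pattern 2056 [:: Corner 1; Corner 2; Arc 43 13; Tip 2; Arc 65 1; Corner 3] false [:: Tip 0; Arc 16 3; Tip 1];
    Pattern 7944 [:: Corner 1; Corner 2; Arc 41 11; Tip 2; Corner 3] false [:: Tip 0; Arc 15 10]]))
  (Leaf 1008639 [:: Pattern 3049 [:: Corner 1; Corner 2; Arc 43 13; Tip 2; Corner 3] false [:: Tip 0; Arc 16 3; Tip 1; Arc 24 1];
    Pattern 1507 [:: Corner 1; Corner 2; Arc 43 13; Tip 2; Corner 3; Corner 0] false [:: Tip 0; Arc 16 3; Tip 1; Arc 24 1];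
    Pattern 5445 [:: Corner 1; Corner 2; Arc 43 11; Tip 2; Corner 3] false [:: Tip 0; Arc 15 9]])))
  (Leaf 1008639 [:: Pattern 4380 [:: Corner 1; Corner 2; Arc 44 6; Tip 2; Arc 65 1] true [:: Arc 13 11];
    Pattern 1088 [:: Corner 1; Corner 2; Arc 44 6; Tip 2; Corner 3] false [:: Tip 0; Arc 13 11];
    Pattern 4532 [:: Corner 1; Corner 2; Arc 44 7; Tip 2; Arc 65 1; Corner 3] false [:: Tip 0; Arc 14 5; Tip 1]]))
  (Leaf 1008639 [:: Pattern 8060 [:: Corner 1; Corner 2; Arc 45 6; Tip 2; Arc 65 2; Tip 0] false [:: Arc 14 8];
    Pattern 1940 [:: Corner 1; Corner 2; Arc 49 14; Corner 3] false [:: Tip 0; Arc 15 4; Tip 1]]))))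
  (Leaf 1008639 [:: Pattern 738 [:: Arc 36 23; Corner 3; Corner 0] false [:: Tip 0; Arc 16 20];
    Pattern 9262 [:: Corner 1; Corner 2; Tip 2; Corner 3; Corner 0] false [:: Tip 0; Arc 13 6; Tip 1]]))))
  (Leaf 1008639 [:: Pattern 1391 [:: Arc 36 26; Corner 3; Corner 0] false [:: Arc 15 21];
    Pattern 8609 [:: Corner 1; Corner 2; Arc 47 16; Corner 3; Corner 0] false [:: Tip 0; Arc 18 1; Tip 1]]))
  (Leaf 1008639 [:: Pattern 6472 [:: Arc 36 18; Tip 2; Tip 0] false [:: Arc 15 21];
    Pattern 2469 [:: Arc 36 26; Corner 3; Corner 0] false [:: Tip 0; Tip 1; Corner 1];
    Pattern 1059 [:: Corner 1; Corner 2; Arc 47 6; Tip 2; Tip 0] false [:: Arc 15 12]]))))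
  (Leaf 1035284 [:: Pattern 3668 [:: Corner 2; Arc 43 19; Corner 3; Corner 0] false [:: Tip 1];
    Pattern 6332 [:: Corner 1; Corner 2; Arc 47 16; Corner 3] false [:: Tip 0; Tip 1]])))))
  (Leaf 1154708 [:: Pattern 6957 [:: Corner 2; Arc 43 19; Corner 3; Corner 0] false [:: Tip 1];
    Pattern 3043 [:: Corner 1; Corner 2; Arc 47 16; Corner 3; Corner 0] false [:: Tip 0; Tip 1]])))
  (Leaf 1154708 [:: Pattern 10000 [:: Arc 36 18; Tip 2; Tip 0] false [:: Tip 1; Arc 19 17]])))
  (Leaf 1154708 [:: Pattern 10000 [:: Corner 1; Corner 2; Arc 47 16; Corner 3; Corner 0] false [:: Tip 0; Tip 1]]))
  (Leaf 1154708 [:: Pattern 10000 [:: Corner 1; Corner 2; Arc 50 9; Corner 3; Corner 0] false [:: Arc 8 21]])))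
  (Leaf 1154708 [:: Pattern 10000 [:: Corner 1; Corner 2; Corner 3; Corner 0] false [:: Arc 0 37]])))
  (Leaf 1154708 [:: Pattern 10000 [:: Corner 1; Corner 2; Arc 46 9; Tip 2; Tip 0] false [:: Tip 1; Arc 18 9]]))
  (Leaf 1154708 [:: Pattern 10000 [:: Corner 1; Corner 2; Arc 50 23] false [:: Arc 1 22]])))
  (Leaf 1154708 [:: Pattern 10000 [:: Corner 1; Corner 2; Arc 54 19] false [:: Arc 1 18]]).

(** The two vectors point in the directions of -30 and 30 degrees. Since 50000 sqrt 3 is rounded
    down to 86602, the sector between them is slightly wider than needed. *)
Lemma check_the_certificate : check whole_box (86602, -50000) (86602, 50000) the_certificate.
Proof. by vm_compute. Qed.
End Data.

(** * Placements of the three sets *)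

(* Numerals of [R] are unary, so that large ones have to be decomposed. *)
Definition thousand : Z := Z.mul (Z.of_nat 10) (Z.mul (Z.of_nat 10) (Z.of_nat 10)).

Definition dec3 (a b c : nat) : Z :=
  Z.add (Z.mul (Z.add (Z.mul (Z.of_nat a) thousand) (Z.of_nat b)) thousand) (Z.of_nat c).

Section Placement.
Variable R : realType.
Local Notation P := (R * R)%type.
Local Notation mu := (@lebesgue_measure R).
Local Notation mu2 := (mu \x mu)%E.
Local Notation Zr := (@Zr R).
Implicit Types (S A : set P) (p q c z : P).

Lemma Zr_nat n : Zr (Z.of_nat n) = n%:R.
Proof. by rewrite /Zr; have -> : int_of_Z (Z.of_nat n) = n by lia. Qed.

Lemma Zr_thousand : Zr thousand = 10 ^+ 3.
Proof. by rewrite /thousand !ZrM !Zr_nat; ring. Qed.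

Lemma Zr_dec3 a b d : Zr (dec3 a b d) = (a%:R * 10 ^+ 3 + b%:R) * 10 ^+ 3 + d%:R.
Proof. by rewrite /dec3 ZrD ZrM ZrD ZrM !Zr_nat Zr_thousand. Qed.

Lemma shoelace_scale (k : R) (s : seq P) :
  shoelace [seq (p.1 / k, p.2 / k) | p <- s] = shoelace s / (k * k).
Proof.
have crossesE p u : crosses (p.1 / k, p.2 / k) [seq (q.1 / k, q.2 / k) | q <- u] = crosses p u / (k * k).
  elim: u p => [|q u ih] p /=; first by rewrite mul0r.
  by rewrite ih /cross /= invfM; ring.
case: s => [|p s] /=; first by rewrite mul0r.
by rewrite -crossesE map_rcons.
Qed.

Lemma convex2_comb3 S p q r (a b d : R) : convex2 S -> S p -> S q -> S r ->
  0 <= a -> 0 <= b -> 0 <= d -> a + b + d = 1 ->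
  S (a * p.1 + b * q.1 + d * r.1, a * p.2 + b * q.2 + d * r.2).
Proof.
move=> cS Sp Sq Sr a0 b0 d0 abd.
have [bd|bd] := eqVneq (b + d) 0.
  have [b0' d0'] : b = 0 /\ d = 0 by split; lra.
  have a1 : a = 1 by lra.
  by rewrite b0' d0' a1 !mul0r !addr0 !mul1r; case: (p) Sp.
have bd0 : 0 < b + d by rewrite lt_neqAle eq_sym bd addr_ge0.
pose m := ((1 - d / (b + d)) * q.1 + d / (b + d) * r.1,
           (1 - d / (b + d)) * q.2 + d / (b + d) * r.2).
have Sm : S m.
  by apply: cS => //; [rewrite divr_ge0 // ltW|rewrite ler_pdivrMr // mul1r lerDr].
have -> : (a * p.1 + b * q.1 + d * r.1, a * p.2 + b * q.2 + d * r.2) =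
    ((1 - (b + d)) * p.1 + (b + d) * m.1, (1 - (b + d)) * p.2 + (b + d) * m.2).
  have -> : a = 1 - (b + d) by lra.
  by rewrite /m /=; congr (_, _); field.
by apply: cS => //; lra.
Qed.

Local Notation s3 := (Num.sqrt 3 : R).

Lemma sqrt3_sqr : s3 * s3 = 3.
Proof. by rewrite -expr2 sqr_sqrtr. Qed.

Lemma sqrt3_ge0 : 0 <= s3. Proof. exact: sqrtr_ge0. Qed.

Lemma sqrt3_bounds : (1 + 732 / 10 ^+ 3 + 5 / 10 ^+ 5 <= s3) /\ (s3 <= 1 + 732 / 10 ^+ 3 + 51 / 10 ^+ 6).
Proof.
have := sqrt3_sqr; have := sqrt3_ge0; move: (s3) => s s0 ss.
by split; rewrite leNgt; apply/negP; nra.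
Qed.

(* the vertices are c + (sqrt 3 / 9) w z for the cube roots of unity w *)
Definition has_triangle S c z := [/\
  S (c.1 + s3 / 9 * z.1, c.2 + s3 / 9 * z.2),
  S (c.1 - s3 / 18 * z.1 - z.2 / 6, c.2 - s3 / 18 * z.2 + z.1 / 6) &
  S (c.1 - s3 / 18 * z.1 + z.2 / 6, c.2 - s3 / 18 * z.2 - z.1 / 6)].

(** In the plane of complex numbers the point is c + (x + i y) z, and the three nonnegative
    quantities are three times its barycentric coordinates. *)
Lemma has_triangle_mem S c z (x y : R) : convex2 S -> has_triangle S c z ->
  0 <= 1 + 6 * s3 * x -> 0 <= 1 - 3 * s3 * x + 9 * y -> 0 <= 1 - 3 * s3 * x - 9 * y ->
  S (c.1 + (x * z.1 - y * z.2), c.2 + (x * z.2 + y * z.1)).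
Proof.
move=> cS [S0 S1 S2] w0 w1 w2.
have wE : (1 + 6 * s3 * x) / 3 + (1 - 3 * s3 * x + 9 * y) / 3 + (1 - 3 * s3 * x - 9 * y) / 3 = 1.
  by field.
have := convex2_comb3 cS S0 S1 S2 (divr_ge0 w0 _) (divr_ge0 w1 _) (divr_ge0 w2 _) wE.
move=> /(_ (ler0n _ _) (ler0n _ _) (ler0n _ _)) /=.
congr S; have ss := sqrt3_sqr; congr (_, _).
  transitivity (c.1 + (x * z.1 * (s3 * s3) / 3 - y * z.2)); last by rewrite ss; field.
  by field.
transitivity (c.2 + (x * z.2 * (s3 * s3) / 3 + y * z.1)); last by rewrite ss; field.
by field.
Qed.

(** Multiplying z by a primitive cube root of unity permutes the vertices cyclically. *)
Lemma has_triangle_rot S c z : has_triangle S c z ->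
  has_triangle S c (- z.1 / 2 - s3 / 2 * z.2, - z.2 / 2 + s3 / 2 * z.1).
Proof.
case=> S0 S1 S2; have ss := sqrt3_sqr; split; rewrite /=.
- move: S1; congr S; congr (_, _).
    transitivity (c.1 - s3 / 18 * z.1 - (s3 * s3) * z.2 / 18); last by field.
    by rewrite ss; field.
  transitivity (c.2 - s3 / 18 * z.2 + (s3 * s3) * z.1 / 18); last by field.
  by rewrite ss; field.
- move: S2; congr S; congr (_, _).
    transitivity (c.1 - s3 / 18 * z.1 + z.2 / 12 + (s3 * s3) * z.2 / 36); last by field.
    by rewrite ss; field.
  transitivity (c.2 - s3 / 18 * z.2 - z.1 / 12 - (s3 * s3) * z.1 / 36); last by field.
  by rewrite ss; field.
- move: S0; congr S; congr (_, _).
    transitivity (c.1 + s3 / 9 * z.1 + z.2 / 12 * ((s3 * s3) / 3 - 1)); first by rewrite ss; field.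
    by field.
  transitivity (c.2 + s3 / 9 * z.2 - z.1 / 12 * ((s3 * s3) / 3 - 1)); first by rewrite ss; field.
  by field.
Qed.

(** For a unit vector: the argument of z is at most 30 degrees in absolute value. *)
Definition in_sector z := s3 * z.2 <= z.1 /\ - (s3 * z.2) <= z.1.

(** The sector, its opposite and their turns by multiples of 120 degrees are six sectors of 60
    degrees, which cover the plane. The signs of z.1 and of z.1 -+ sqrt 3 z.2 tell which rotation to
    take. *)
Lemma in_sector_rot z : exists w : P, [/\ in_sector w \/ in_sector (- w.1, - w.2),
  (w.1 ^+ 2 + w.2 ^+ 2 = z.1 ^+ 2 + z.2 ^+ 2) &
  (forall S c, has_triangle S c z -> has_triangle S c w)].
Proof.
pose rot z : P := (- z.1 / 2 - s3 / 2 * z.2, - z.2 / 2 + s3 / 2 * z.1).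
have ss := sqrt3_sqr.
have rot_norm w : (rot w).1 ^+ 2 + (rot w).2 ^+ 2 = w.1 ^+ 2 + w.2 ^+ 2.
  transitivity ((1 + s3 * s3) / 4 * (w.1 ^+ 2 + w.2 ^+ 2)); first by rewrite /rot /=; field.
  by rewrite ss; field.
have rotE w : s3 * (rot w).2 = - (s3 * w.2) / 2 + 3 / 2 * w.1.
  transitivity (- (s3 * w.2) / 2 + (s3 * s3) / 2 * w.1); last by rewrite ss.
  by rewrite /rot /=; field.
have rot1 w : (rot w).1 = - w.1 / 2 - (s3 * w.2) / 2 by rewrite /rot /=; field.
have rot2E w : s3 * (rot (rot w)).2 = - (s3 * w.2) / 2 - 3 / 2 * w.1.
  by rewrite rotE rotE rot1; lra.
have rot21 w : (rot (rot w)).1 = - w.1 / 2 + (s3 * w.2) / 2.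
  by rewrite rot1 rot1 rotE; lra.
have [w [wz H]] : exists w, (w = z \/ w = rot z \/ w = rot (rot z)) /\ (in_sector w \/ in_sector (- w.1, - w.2)).
  rewrite /in_sector /=.
  have [x0|/ltW x0] := leP 0 z.1; have [a0|/ltW a0] := leP 0 (z.1 - s3 * z.2);
  have [b0|/ltW b0] := leP 0 (z.1 + s3 * z.2);
  first [ by exists z; rewrite ?mulrN; split; [left|lra]
        | by exists (rot z); rewrite ?mulrN rotE rot1; split; [right; left|lra]
        | by exists (rot (rot z)); rewrite ?mulrN rot2E rot21; split; [right; right|lra] ].
exists w; split=> //.
  by case: wz => [->//|[->|->]]; rewrite ?rot_norm.
by move=> S c zT; case: wz => [->//|[->|->]]; do ?apply: has_triangle_rot.
Qed.

Lemma sector_cone (x y : R) : s3 * x <= y -> - (s3 * x) <= y ->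
  0 <= ((0 * 10 ^+ 3 + 86) * 10 ^+ 3 + 602) * x - - ((0 * 10 ^+ 3 + 50) * 10 ^+ 3 + 0) * y.
Proof.
move=> xy1 xy2; have [s_ge _] := sqrt3_bounds.
have [x0|/ltW x0] := leP 0 x; first by nra.
have := ler_wnM2r x0 s_ge; lra.
Qed.

Definition million : R := 10 ^+ 3 * 10 ^+ 3.

Lemma in_whole_box (p q : P) :
  `|p.1| <= 6 * million -> `|p.2| <= million / 2 ->
  `|q.1| <= 6 * million -> `|q.2| <= million / 2 ->
  in_box p (q.1 - p.1, q.2 - p.2) whole_box.
Proof.
have dec a b d x : dec3 a b d = x -> Zr x = (a%:R * 10 ^+ 3 + b%:R) * 10 ^+ 3 + d%:R.
  by move=> <-; exact: Zr_dec3.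
have decN a b d x : Z.opp (dec3 a b d) = x -> Zr x = - ((a%:R * 10 ^+ 3 + b%:R) * 10 ^+ 3 + d%:R).
  by move=> <-; rewrite ZrN Zr_dec3.
have m6 : (6 * 10 ^+ 3 + 0) * 10 ^+ 3 + 0 = 6 * million by rewrite /million; ring.
have m12 : (12 * 10 ^+ 3 + 0) * 10 ^+ 3 + 0 = 12 * million by rewrite /million; ring.
have m1 : (1 * 10 ^+ 3 + 0) * 10 ^+ 3 + 0 = million by rewrite /million; ring.
have m5 : (0 * 10 ^+ 3 + 500) * 10 ^+ 3 + 0 = million / 2 by rewrite /million; field.
rewrite /in_box /in_range /= (decN 6 0 0) // (dec 6 0 0) // (decN 0 500 0) // (dec 0 500 0) //.
rewrite (decN 12 0 0) // (dec 12 0 0) // (decN 1 0 0) // (dec 1 0 0) //.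
rewrite {}m6 {}m12 {}m1 {}m5 !ler_norml; clear dec decN; move: million => M.
by move=> /andP[? ?] /andP[? ?] /andP[? ?] /andP[? ?]; split; apply/andP; split; lra.
Qed.

(** Supplies the hypotheses of [has_triangle_mem] for [tips]. They hold because of the rounding
    towards the centre, as with 192450 in place of 10^6 sqrt 3 / 9 = 192450.09... *)
Lemma tip_weights (K x y : R) : K = 10 ^+ 3 * 10 ^+ 3 ->
  [\/ x = 192 * 10 ^+ 3 + 450 /\ y = 0,
      x = - (96 * 10 ^+ 3 + 225) /\ y = 166 * 10 ^+ 3 + 666 |
      x = - (96 * 10 ^+ 3 + 225) /\ y = - (166 * 10 ^+ 3 + 666)] ->
  [/\ 0 <= 1 + 6 * s3 * (x / K), 0 <= 1 - 3 * s3 * (x / K) + 9 * (y / K) &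
      0 <= 1 - 3 * s3 * (x / K) - 9 * (y / K)].
Proof.
have [s_ge s_le] := sqrt3_bounds.
move=> ->; have -> : (10 ^+ 3 * 10 ^+ 3)^-1 = (1 / 10 ^+ 3) * (1 / 10 ^+ 3) :> R by field.
move: (s3) s_ge s_le => s s_ge s_le.
by case=> -[-> ->]; split; lra.
Qed.

(** The triangles over the short sides bound the abscissa of q: its distance to their lines is below
    2 * 0.0975 / 0.0375 = 5.2. Those over the long sides bound the ordinate, with 2 * 0.0975 /
    0.4625 < 0.422. *)
Lemma large_triangles (X Y : R) (q : P) :
  X = 231 * 10 ^+ 3 + 250 -> Y = 18 * 10 ^+ 3 + 750 ->
  shoelace [:: (X, - Y); (X, Y); q] < 195 * 10 ^+ 3 * 10 ^+ 3 * 10 ^+ 3 ->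
  shoelace [:: q; (- X, Y); (- X, - Y)] < 195 * 10 ^+ 3 * 10 ^+ 3 * 10 ^+ 3 ->
  shoelace [:: (- X, - Y); (X, - Y); q] < 195 * 10 ^+ 3 * 10 ^+ 3 * 10 ^+ 3 ->
  shoelace [:: q; (X, Y); (- X, Y)] < 195 * 10 ^+ 3 * 10 ^+ 3 * 10 ^+ 3 ->
  `|q.1| <= 6 * million /\ `|q.2| <= million / 2.
Proof.
case: q => x y; rewrite /million /= /cross /= !ler_norml => -> -> H1 H2 H3 H4.
by split; apply/andP; split; lra.
Qed.

Lemma area_ge_sector S o c z : convex2 S -> z.1 ^+ 2 + z.2 ^+ 2 = 1 -> in_sector z ->
  S (37 / 160, 3 / 160) -> S (- (37 / 160), 3 / 160) ->
  S (- (37 / 160), - (3 / 160)) -> S (37 / 160, - (3 / 160)) ->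
  (forall p, (p.1 - o.1) ^+ 2 + (p.2 - o.2) ^+ 2 <= (1 / (2 * pi)) ^+ 2 -> S p) ->
  has_triangle S c z -> area_ge S (39 / 400).
Proof.
move=> cS z1 zs S0 S1 S2 S3 disc tri A mA SA; rewrite leNgt; apply/negP => lt.
have dec a b d (x : Z) : dec3 a b d = x -> Zr x = (a%:R * 10 ^+ 3 + b%:R) * 10 ^+ 3 + d%:R.
  by move=> <-; exact: Zr_dec3.
(* [kk] serves here as the number 10^6 of integer units per unit of length. *)
have KE := dec 1 0 0 kk erefl.
have K0 : 0 < Zr kk :> R by rewrite KE; lra.
have targetE : Zr target = (195 * 10 ^+ 3 * 10 ^+ 3) * 10 ^+ 3 :> R.
  have -> : target = Z.mul (dec3 195 0 0) thousand by [].
  by rewrite ZrM Zr_dec3 Zr_thousand; lra.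
move: (Zr kk : R) KE K0 => K KE K0.
pose St (q : P) := S (q.1 / K, q.2 / K).
have scaled_path (le1 : rel P) s :
    (forall p q, le1 p q -> le1 (p.1 / K, p.2 / K) (q.1 / K, q.2 / K)) ->
    sorted le1 s -> sorted le1 [seq (p.1 / K, p.2 / K) | p <- s].
  by move=> le1K; rewrite sorted_map; apply: sub_sorted => p q; exact: le1K.
have leK (p q : P) : le_fst p q -> le_fst (p.1 / K, p.2 / K) (q.1 / K, q.2 / K).
  by rewrite /le_fst /= ler_pM2r // invr_gt0.
have St_shoelace (s t : seq P) : s != [::] -> t != [::] ->
    (forall q, q \in s ++ t -> St q) ->
    sorted (@le_fst R) s -> sorted (fun p q => le_fst q p) t ->
    shoelace (s ++ t) < Zr target.
  move=> s0 t0 Sst ss ts.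
  have := @shoelace_area R S A [seq (p.1 / K, p.2 / K) | p <- s] [seq (p.1 / K, p.2 / K) | p <- t] cS mA SA.
  have ne (u : seq P) : u != [::] -> [seq (p.1 / K, p.2 / K) | p <- u] != [::] by case: u.
  move=> /(_ (ne _ s0) (ne _ t0)) H.
  have {}H := le_lt_trans (H _ (scaled_path _ _ leK ss) (scaled_path _ _ (fun p q => @leK q p) ts)) lt.
  have := H _; rewrite -map_cat lte_fin shoelace_scale => {}H.
  have : shoelace (s ++ t) / (K * K) / 2 < 39 / 400.
    by apply: H => q /mapP[p pst ->]; exact: Sst.
  rewrite ltr_pdivrMr // ltr_pdivrMr ?mulr_gt0 // targetE KE; lra.
(* To be applied to the centres of the disc and of the triangle, both of which belong to S. *)
have point_in_box q : St q -> `|q.1| <= 6 * million /\ `|q.2| <= million / 2.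
  move=> Sq.
  pose X : R := K * (37 / 160); pose Y : R := K * (3 / 160).
  have XK : X / K = 37 / 160 by rewrite /X mulrAC divff ?mul1r // gt_eqF.
  have YK : Y / K = 3 / 160 by rewrite /Y mulrAC divff ?mul1r // gt_eqF.
  have C0 : St (X, Y) by rewrite /St /= XK YK.
  have C1 : St (- X, Y) by rewrite /St /= mulNr XK YK.
  have C2 : St (- X, - Y) by rewrite /St /= !mulNr XK YK.
  have C3 : St (X, - Y) by rewrite /St /= mulNr XK YK.
  have XE : X = 231 * 10 ^+ 3 + 250 by rewrite /X KE; lra.
  have YE : Y = 18 * 10 ^+ 3 + 750 by rewrite /Y KE; lra.
  have X_gt0 : 0 < X by rewrite /X mulr_gt0.
  clearbody X Y.
  have mem3 p1 p2 p3 : St p1 -> St p2 -> St p3 -> forall p, p \in [:: p1; p2; p3] -> St p.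
    by move=> s1 s2 s3' p; rewrite !inE => /or3P[] /eqP->.
  have right := St_shoelace [:: (X, - Y); (X, Y)] [:: q] erefl erefl (mem3 _ _ _ C3 C0 Sq) _ erefl.
  have left := St_shoelace [:: q] [:: (- X, Y); (- X, - Y)] erefl erefl (mem3 _ _ _ Sq C1 C2) erefl _.
  have top := St_shoelace [:: (- X, - Y); (X, - Y)] [:: q] erefl erefl (mem3 _ _ _ C2 C3 Sq) _ erefl.
  have bottom := St_shoelace [:: q] [:: (X, Y); (- X, Y)] erefl erefl (mem3 _ _ _ Sq C0 C1) erefl _.
  move: right left top bottom; rewrite /le_fst /cross /= targetE !andbT lexx => right left top bottom.
  have {}right := right erefl; have {}left := left (lexx _).
  have X0 : - X <= X by apply: le_trans (ltW X_gt0); rewrite oppr_le0 ltW.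
  have {}top := top X0; have {}bottom := bottom X0.
  exact: (large_triangles XE YE right left top bottom).
have decN a b d x : Z.opp (dec3 a b d) = x -> Zr x = - ((a%:R * 10 ^+ 3 + b%:R) * 10 ^+ 3 + d%:R).
  by move=> <-; rewrite ZrN Zr_dec3.
have St_disc v : v \in disc_points -> St (K * o.1 + Zr v.1, K * o.2 + Zr v.2).
  pose r := dec3 0 159 149.
  have /allP H : all (fun v => Z.leb (dotv v v) (Z.mul r r)) disc_points by vm_compute.
  move=> /H /Z.leb_le /(@Zr_le R); rewrite /dotv ZrD !ZrM => vr.
  have rE := Zr_dec3 0 159 149; rewrite -/r in rE.
  move: (Zr r) (Zr v.1) (Zr v.2) rE vr => {r H} r x y rE xyr.
  (* This needs 0.318298 pi <= 1, which the bound 3.1417 of pi just provides. *)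
  have rK : r / K <= 1 / (2 * pi).
    rewrite ler_pdivrMr // mulrAC ler_pdivlMr ?mul1r; last by rewrite mulr_gt0 ?pi_gt0.
    by rewrite rE KE; have := pi_le R; have := pi_gt0 R; lra.
  have r0 : 0 <= r / K by rewrite divr_ge0 ?(ltW K0) // rE; lra.
  apply: disc => /=.
  have -> : ((K * o.1 + x) / K - o.1) ^+ 2 + ((K * o.2 + y) / K - o.2) ^+ 2 =
      (x * x + y * y) / (K * K) by field; rewrite gt_eqF.
  apply: (@le_trans _ _ ((r / K) ^+ 2)).
    by rewrite expr2 mulrACA -invfM ler_pM2r // invr_gt0 mulr_gt0.
  by rewrite ler_pXn2r ?nnegrE //; apply: le_trans r0 rK.
have St_point x y (u w : R) : Zr x = K * u -> Zr y = K * w -> S (u, w) -> St (Zr x, Zr y).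
  by move=> -> ->; rewrite /St /= ![K * _]mulrC !mulfK // gt_eqF.
have St_corner v : v \in corners -> St (Zr v.1, Zr v.2).
  rewrite !inE => /or4P[] /eqP->.
  - by apply: St_point S0; [rewrite (dec 0 231 250)//|rewrite (dec 0 18 750)//]; rewrite KE; lra.
  - by apply: St_point S1; [rewrite (decN 0 231 250)//|rewrite (dec 0 18 750)//]; rewrite KE; lra.
  - by apply: St_point S2; [rewrite (decN 0 231 250)//|rewrite (decN 0 18 750)//]; rewrite KE; lra.
  - by apply: St_point S3; [rewrite (dec 0 231 250)//|rewrite (decN 0 18 750)//]; rewrite KE; lra.
have St_tip v : v \in tips ->
    St (K * c.1 + (Zr v.1 * z.1 - Zr v.2 * z.2), K * c.2 + (Zr v.1 * z.2 + Zr v.2 * z.1)).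
  move=> vt.
  have -> : (K * c.1 + (Zr v.1 * z.1 - Zr v.2 * z.2), K * c.2 + (Zr v.1 * z.2 + Zr v.2 * z.1)) =
     (K * (c.1 + (Zr v.1 / K * z.1 - Zr v.2 / K * z.2)), K * (c.2 + (Zr v.1 / K * z.2 + Zr v.2 / K * z.1))).
    by congr (_, _); field; rewrite gt_eqF.
  rewrite /St /= ![K * _]mulrC !mulfK ?gt_eqF //.
  have [s_ge s_le] := sqrt3_bounds.
  have tipE : [\/ Zr v.1 = 192 * 10 ^+ 3 + 450 /\ Zr v.2 = 0,
      Zr v.1 = - (96 * 10 ^+ 3 + 225) /\ Zr v.2 = 166 * 10 ^+ 3 + 666 |
      Zr v.1 = - (96 * 10 ^+ 3 + 225) /\ Zr v.2 = - (166 * 10 ^+ 3 + 666)].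
    move: vt {s_ge s_le targetE}; rewrite !inE => /or3P[] /eqP-> /=.
    - by constructor 1; split; first by rewrite (dec 0 192 450)//; lra.
    - by constructor 2; split; [rewrite (decN 0 96 225)//|rewrite (dec 0 166 666)//]; lra.
    - by constructor 3; split; [rewrite (decN 0 96 225)//|rewrite (decN 0 166 666)//]; lra.
  have KM : K = 10 ^+ 3 * 10 ^+ 3 by rewrite KE; ring.
  have [w0 w1 w2] := tip_weights KM tipE.
  exact: has_triangle_mem.
apply: (@check_sound R (K * o.1, K * o.2) (K * (c.1 - o.1), K * (c.2 - o.2)) z z1 St _ St_shoelace
  the_certificate whole_box _ _ _ _ _ check_the_certificate).
- case=> [i k|i|i] q.
  + rewrite -map_comp => /mapP[v /mem_take /mem_drop /St_disc Sv ->] /=.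
    by move: Sv; congr St; congr (_, _); rewrite /= !Zr0 (_ : Zr (Zpos xH) = 1)//; ring.
  + rewrite inE => /eqP->; set v := nth _ _ _.
    have /St_corner Sv : v \in corners.
      by rewrite /v; have [ilt|ige] := ltnP i (size corners); [exact: mem_nth|rewrite nth_default].
    by move: Sv; congr St; congr (_, _); rewrite /= !Zr0; ring.
  + rewrite inE => /eqP->; set v := nth _ _ _.
    have /St_tip Sv : v \in tips.
      by rewrite /v; have [ilt|ige] := ltnP i (size tips); [exact: mem_nth|rewrite nth_default].
    by move: Sv; congr St; congr (_, _); rewrite /= !Zr0 (_ : Zr (Zpos xH) = 1)//; ring.
- have oS : St (K * o.1, K * o.2).
    rewrite /St /= ![K * _]mulrC !mulfK ?gt_eqF //; apply: disc; rewrite !subrr.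
    by rewrite expr0n /= addr0 sqr_ge0.
  have cS' : St (K * c.1, K * c.2).
    rewrite /St /= ![K * _]mulrC !mulfK ?gt_eqF //.
    have := @has_triangle_mem S c z 0 0 cS tri; rewrite !mul0r !mulr0 !addr0 !subr0 !addr0.
    by apply; exact: ler01.
  have [h1 h2] := point_in_box _ oS; have [h3 h4] := point_in_box _ cS'.
  by rewrite !mulrBr; exact: (@in_whole_box (K * o.1, K * o.2) (K * c.1, K * c.2)).
- rewrite /cross /real_vec /= (dec 0 86 602) // (decN 0 50 0) //.
  by apply: (@sector_cone (z.2) (z.1)); case: zs => ? ?.
- rewrite /cross /real_vec /= (dec 0 50 0) // (dec 0 86 602) //.
  by have := @sector_cone (- z.2) z.1; rewrite !mulrN opprK; case: zs => u w /(_ w u); lra.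
Qed.

End Placement.

(** * Normalising the position of the rectangle *)

Section Isometries.
Variable R : realType.
Local Notation P := (R * R)%type.
Local Notation s3 := (Num.sqrt 3 : R).
Implicit Types (S : set P) (p q : P).

(** The half-turn is composed of two quarter turns, as the product of shears requires a nonnegative
    cosine. *)
Lemma area_preserving_opp : area_preserving (fun p : P => (- p.1, - p.2)).
Proof.
have -> : (fun p : P => (- p.1, - p.2)) = isometry 0 1 (0, 0) \o isometry 0 1 (0, 0).
  by apply/funext => -[x y]; rewrite /isometry /=; congr (_, _); ring.
by apply: area_preserving_comp; apply: area_preserving_isometry; rewrite ?expr1n ?expr0n ?add0r.
Qed.

Lemma area_preserving_rotation (c s : R) (v : P) :
  c ^+ 2 + s ^+ 2 = 1 -> area_preserving (isometry c s v).
Proof.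
move=> cs1; have [c0|/ltW c0] := leP 0 c; first exact: area_preserving_isometry.
have -> : isometry c s v = isometry (- c) (- s) v \o (fun p : P => (- p.1, - p.2)).
  by apply/funext => -[x y]; rewrite /isometry /=; congr (_, _); ring.
apply: area_preserving_comp; last exact: area_preserving_opp.
by apply: area_preserving_isometry; rewrite ?sqrrN // oppr_ge0.
Qed.

Definition isometry_inv (c s : R) (v p : P) : P :=
  (c * (p.1 - v.1) + s * (p.2 - v.2), - s * (p.1 - v.1) + c * (p.2 - v.2)).

Lemma isometry_invD (c s : R) (v p : P) (x y : R) : c ^+ 2 + s ^+ 2 = 1 ->
  isometry c s v ((isometry_inv c s v p).1 + x, (isometry_inv c s v p).2 + y) =
  (p.1 + (c * x - s * y), p.2 + (s * x + c * y)).
Proof.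
move=> cs1; rewrite /isometry /isometry_inv /=; congr (_, _).
  transitivity ((c ^+ 2 + s ^+ 2) * (p.1 - v.1) + v.1 + (c * x - s * y)); first by ring.
  by rewrite cs1; ring.
transitivity ((c ^+ 2 + s ^+ 2) * (p.2 - v.2) + v.2 + (s * x + c * y)); first by ring.
by rewrite cs1; ring.
Qed.

Lemma convex2_isometry S (c s : R) (v : P) : convex2 S -> convex2 (isometry c s v @^-1` S).
Proof.
move=> cS p q Sp Sq t t0 t1; have := cS _ _ Sp Sq t t0 t1.
by rewrite /preimage /= /isometry /=; congr S; congr (_, _); ring.
Qed.

Lemma convex2_opp S : convex2 S -> convex2 ((fun p : P => (- p.1, - p.2)) @^-1` S).
Proof.
move=> cS p q Sp Sq t t0 t1; have := cS _ _ Sp Sq t t0 t1.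
by rewrite /preimage /=; congr S; congr (_, _); ring.
Qed.

(** A point of the disc lies on a horizontal chord, whose ends are on the circle; a chord of length
    0 is treated apart. *)
Lemma disc_of_circle S (o : P) (r : R) : convex2 S -> 0 <= r ->
  (forall p, (p.1 - o.1) ^+ 2 + (p.2 - o.2) ^+ 2 = r ^+ 2 -> S p) ->
  forall p, (p.1 - o.1) ^+ 2 + (p.2 - o.2) ^+ 2 <= r ^+ 2 -> S p.
Proof.
move=> cS r0 circ p pr.
have d0 : 0 <= r ^+ 2 - (p.2 - o.2) ^+ 2 by have := sqr_ge0 (p.1 - o.1); lra.
pose h := Num.sqrt (r ^+ 2 - (p.2 - o.2) ^+ 2).
have hh : h ^+ 2 = r ^+ 2 - (p.2 - o.2) ^+ 2 by rewrite sqr_sqrtr.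
have h_ge0 : 0 <= h by exact: sqrtr_ge0.
have Sl : S (o.1 - h, p.2) by apply: circ => /=; rewrite (_ : o.1 - h - o.1 = - h) ?sqrrN ?hh; ring.
have Sr : S (o.1 + h, p.2) by apply: circ => /=; rewrite (_ : o.1 + h - o.1 = h) ?hh; ring.
have : (p.1 - o.1) ^+ 2 <= h ^+ 2 by rewrite hh; lra.
rewrite -ler_sqrt ?sqr_ge0 // !sqrtr_sqr (ger0_norm h_ge0) ler_norml => /andP[ph hp].
have [h0|h_neq0] := eqVneq h 0.
  by move: Sr; congr S; case: (p) ph hp => x y /= ph hp; congr (_, _); lra.
have h_gt0 : 0 < h by rewrite lt_neqAle eq_sym h_neq0.
pose t := (p.1 - o.1 + h) / (2 * h).
have -> : p = ((1 - t) * (o.1 - h, p.2).1 + t * (o.1 + h, p.2).1,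
               (1 - t) * (o.1 - h, p.2).2 + t * (o.1 + h, p.2).2).
  by rewrite /t; case: (p) => x y /=; congr (_, _); field.
apply: cS => //; first by rewrite divr_ge0; lra.
by rewrite ler_pdivrMr; lra.
Qed.

(** If the opposite of the direction is in the sector, a half-turn of the plane corrects this and
    maps the centred rectangle to itself. *)
Lemma area_ge_placed S (o c z : P) : convex2 S -> z.1 ^+ 2 + z.2 ^+ 2 = 1 ->
  S (37 / 160, 3 / 160) -> S (- (37 / 160), 3 / 160) ->
  S (- (37 / 160), - (3 / 160)) -> S (37 / 160, - (3 / 160)) ->
  (forall p, (p.1 - o.1) ^+ 2 + (p.2 - o.2) ^+ 2 <= (1 / (2 * pi)) ^+ 2 -> S p) ->
  has_triangle S c z -> area_ge S (39 / 400).
Proof.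
move=> cS z1 S0 S1 S2 S3 disc tri; have [w [sec wz /(_ S c tri) {}tri]] := in_sector_rot z.
rewrite -wz in z1; case: sec => sec; first exact: (area_ge_sector cS z1 sec S0 S1 S2 S3 disc tri).
apply: (area_ge_preimage area_preserving_opp).
apply: (@area_ge_sector _ _ (- o.1, - o.2) (- c.1, - c.2) (- w.1, - w.2)) => //.
- exact: convex2_opp.
- by rewrite /= !sqrrN.
- by rewrite /preimage /= opprK.
- by rewrite /preimage /= !opprK.
- by rewrite /preimage /= opprK.
- move=> p /= hp; apply: disc; move: hp => /=; congr (_ <= _); ring.
- case: tri => T0 T1 T2; split; rewrite /preimage /=.
  + by move: T0; congr S; congr (_, _); ring.
  + by move: T1; congr S; congr (_, _); ring.
  + by move: T2; congr S; congr (_, _); ring.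
Qed.

Lemma segment_left p q : segment p q p.
Proof.
exists 0; first by rewrite /= in_itv /= lexx ler01.
by case: p => x y /=; congr (_, _); ring.
Qed.

Lemma rect1_corners (v : P) : v \in [:: (0, 0); (3 / 80, 0); (3 / 80, 37 / 80); (0, 37 / 80)] ->
  @rect1 R v.
Proof.
rewrite !inE => /or4P[] /eqP->; rewrite /rect1 /=.
- by left; left; left; exact: segment_left.
- by left; left; right; exact: segment_left.
- by left; right; exact: segment_left.
- by right; exact: segment_left.
Qed.

Lemma triangle1_vertices (v : P) : v \in [:: (0, 0); (1 / 3, 0); (1 / 6, s3 / 6)] ->
  @triangle1 R v.
Proof.
rewrite !inE => /or3P[] /eqP->; rewrite /triangle1 /=.
- by left; left; exact: segment_left.
- by left; right; exact: segment_left.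
- by right; exact: segment_left.
Qed.

End Isometries.

Theorem theorem1 (R : realType) (S : set (R * R)) :
  convex2 S ->
  contains_copy S (@circle1 R) ->
  contains_copy S (@triangle1 R) ->
  contains_copy S (@rect1 R) ->
  area_ge S (39 / 400).
Proof.
move=> cS [thc [vc Sc]] [tht [vt St]] [thr [vr Sr]].
(* The rotation by [thr] followed by a quarter turn: the long side of [rect1] is vertical and has to
   become horizontal. The points [v] and [g] are the images of the centres of the rectangle and of
   the triangle. *)
pose c := - sin thr; pose s := cos thr.
have cs1 : c ^+ 2 + s ^+ 2 = 1 by rewrite /c /s sqrrN addrC cos2Dsin2.
pose v := rigid thr vr (3 / 160, 37 / 160).
pose g := rigid tht vt (1 / 6, Num.sqrt 3 / 18).
(* The direction from the centroid to the tip (1/6, sqrt 3 / 6), seen from the rectangle: i e^(i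
   tht) divided by c + i s. *)
pose z : R * R := (s * cos tht - c * sin tht, c * cos tht + s * sin tht).
have z1 : c * z.1 - s * z.2 = - sin tht.
  transitivity (- (c ^+ 2 + s ^+ 2) * sin tht); first by rewrite /z /=; ring.
  by rewrite cs1 mulN1r.
have z2 : s * z.1 + c * z.2 = cos tht.
  transitivity ((c ^+ 2 + s ^+ 2) * cos tht); first by rewrite /z /=; ring.
  by rewrite cs1 mul1r.
have Srect x y : (3 / 160 - y, 37 / 160 + x) \in
    [:: (0, 0); (3 / 80, 0); (3 / 80, 37 / 80); (0, 37 / 80)] -> S (isometry c s v (x, y)).
  move=> xy; have -> : isometry c s v (x, y) = rigid thr vr (3 / 160 - y, 37 / 160 + x).
    by rewrite /isometry /v /rigid /c /s /=; congr (_, _); ring.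
  by apply: Sr; exists (3 / 160 - y, 37 / 160 + x) => //; exact: rect1_corners.
have Stri p : p \in [:: (0, 0); (1 / 3, 0); (1 / 6, Num.sqrt 3 / 6)] -> S (rigid tht vt p).
  by move=> pT; apply: St; exists p => //; exact: triangle1_vertices.
have half1 : 3 / 160 - 3 / 160 = 0 :> R by rewrite subrr.
have half2 : 3 / 160 - - (3 / 160) = 3 / 80 :> R by field.
have half3 : 37 / 160 + 37 / 160 = 37 / 80 :> R by field.
have half4 : 37 / 160 + - (37 / 160) = 0 :> R by rewrite subrr.
apply: (area_ge_preimage (area_preserving_rotation v cs1)).
apply: (@area_ge_placed _ _ (isometry_inv c s v vc) (isometry_inv c s v g) z).
- exact: convex2_isometry.
- transitivity ((c * z.1 - s * z.2) ^+ 2 + (s * z.1 + c * z.2) ^+ 2).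
    transitivity ((c ^+ 2 + s ^+ 2) * (z.1 ^+ 2 + z.2 ^+ 2)); last by ring.
    by rewrite cs1 mul1r.
  by rewrite z1 z2 sqrrN addrC cos2Dsin2.
- by apply: Srect; rewrite half1 half3 !inE eqxx ?orbT.
- by apply: Srect; rewrite half1 half4 !inE eqxx ?orbT.
- by apply: Srect; rewrite half2 half4 !inE eqxx ?orbT.
- by apply: Srect; rewrite half2 half3 !inE eqxx ?orbT.
- apply: disc_of_circle; first exact: convex2_isometry.
    by rewrite divr_ge0 // mulr_ge0 // pi_ge0.
  move=> p hp; rewrite /preimage /=.
  set x := p.1 - (isometry_inv c s v vc).1 in hp; set y := p.2 - (isometry_inv c s v vc).2 in hp.
  have -> : p = ((isometry_inv c s v vc).1 + x, (isometry_inv c s v vc).2 + y).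
    by rewrite /x /y; case: (p) => ? ? /=; congr (_, _); ring.
  rewrite isometry_invD //; set u := c * x - s * y; set w := s * x + c * y.
  apply: Sc; exists (cos thc * u + sin thc * w, - sin thc * u + cos thc * w).
    rewrite /circle1 /= -hp.
    transitivity ((cos thc ^+ 2 + sin thc ^+ 2) * ((c ^+ 2 + s ^+ 2) * (x ^+ 2 + y ^+ 2))).
      by rewrite /u /w; ring.
    by rewrite cos2Dsin2 cs1 !mul1r.
  rewrite /rigid /=; congr (_, _).
    transitivity (vc.1 + (cos thc ^+ 2 + sin thc ^+ 2) * u); first by ring.
    by rewrite cos2Dsin2 mul1r.
  transitivity (vc.2 + (cos thc ^+ 2 + sin thc ^+ 2) * w); first by ring.
  by rewrite cos2Dsin2 mul1r.
(* The direction z is vertical in the frame of [triangle1], so the offset (a + i b) z becomes (-b,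
   a) there. *)
have image (a b : R) : isometry c s v ((isometry_inv c s v g).1 + (a * z.1 - b * z.2),
      (isometry_inv c s v g).2 + (a * z.2 + b * z.1)) =
    rigid tht vt (1 / 6 - b, Num.sqrt 3 / 18 + a).
  rewrite isometry_invD //; congr (_, _).
    transitivity (g.1 + (a * (c * z.1 - s * z.2) - b * (s * z.1 + c * z.2))); first by ring.
    by rewrite z1 z2 /g /rigid /=; ring.
  transitivity (g.2 + (a * (s * z.1 + c * z.2) + b * (c * z.1 - s * z.2))); first by ring.
  by rewrite z1 z2 /g /rigid /=; ring.
have copy (a b : R) x y : x = (isometry_inv c s v g).1 + (a * z.1 - b * z.2) ->
    y = (isometry_inv c s v g).2 + (a * z.2 + b * z.1) ->
    (1 / 6 - b, Num.sqrt 3 / 18 + a) \in [:: (0, 0); (1 / 3, 0); (1 / 6, Num.sqrt 3 / 6)] ->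
    (isometry c s v @^-1` S) (x, y).
  by move=> -> -> ab; rewrite /preimage /= image; exact: Stri.
have e1 : 1 / 6 - 0 = 1 / 6 :> R by rewrite subr0.
have e2 : Num.sqrt 3 / 18 + Num.sqrt 3 / 9 = Num.sqrt 3 / 6 :> R by field.
have e3 : 1 / 6 - 1 / 6 = 0 :> R by rewrite subrr.
have e4 : Num.sqrt 3 / 18 + - (Num.sqrt 3 / 18) = 0 :> R by rewrite subrr.
have e5 : 1 / 6 - - (1 / 6) = 1 / 3 :> R by field.
split.
- by apply: (copy (Num.sqrt 3 / 9) 0); [ring|ring|rewrite e1 e2 !inE eqxx ?orbT].
- by apply: (copy (- (Num.sqrt 3 / 18)) (1 / 6)); [field|field|rewrite e3 e4 !inE eqxx ?orbT].
- by apply: (copy (- (Num.sqrt 3 / 18)) (- (1 / 6))); [field|field|rewrite e5 e4 !inE eqxx ?orbT].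
Qed.
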